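(* Let $d\geqslant 2$ be an integer. Define $$\mathcal Z_{d,W}=\Bigl\{\mathbf x\in \mathsf T_d:~\liminf_{N\to \infty} |S_d(\mathbf x; N)|=0\Bigr\}\qquad\text{and}\qquad \mathcal Z_{d,G}=\Bigl\{x\in \mathsf T:~\liminf_{N\to \infty} |G_d(x; N)|=0\Bigr\}.$$ Then $$\dim_H \mathcal Z_{d,W}\geqslant 6/5 \qquad\text{and}\qquad \dim_H \mathcal Z_{d,G}\geqslant \frac{4}{2d+1}.$$
   Context: $\mathsf T_d=(\mathbb R/\mathbb Z)^d$, identified with $[0,1)^d\subseteq\mathbb R^d$ (so $\mathsf T=\mathsf T_1$ is identified with $[0,1)$), and $\dim_H$ denotes Hausdorff dimension in $\mathbb R^d$. Write $e(x)=\exp(2\pi i x)$. For $\mathbf x=(x_1,\ldots,x_d)\in\mathsf T_d$ and $N\in\mathbb N$, $S_d(\mathbf x;N)=\sum_{n=1}^N e(x_1n+\cdots+x_dn^d)$, and for $x\in\mathsf T$, $G_d(x;N)=\sum_{n=1}^N e(xn^d)$. *)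

(* Defs.v *)
From mathcomp Require Import all_boot all_order all_algebra.
From mathcomp Require Import complex.
From mathcomp Require Import all_classical all_reals all_analysis.

Set Implicit Arguments.
Unset Strict Implicit.
Unset Printing Implicit Defensive.

Import Order.TTheory GRing.Theory Num.Theory.
Import numFieldNormedType.Exports.

Local Open Scope classical_set_scope.
Local Open Scope complex_scope.
Local Open Scope ring_scope.

(* The distance is an explicit parameter because the library norm on row
   vectors is the sup norm, whereas R^d carries the Euclidean metric. *)
Section hausdorff_dimension.
Context {R : realType} {T : Type} (dist : T -> T -> R).

(* The maximum with 0 only matters for the empty set, whose supremum is -oo. *)
Definition diameter (U : set T) : \bar R :=
  maxe 0%E (ereal_sup [set (dist z.1 z.2)%:E | z in U `*` U]).

Definition delta_cover (delta : R) (A : set T) (U : nat -> set T) : Prop :=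
  A `<=` \bigcup_i U i /\ forall i, (diameter (U i) <= delta%:E)%E.

Definition hausdorff_premeasure (s delta : R) (A : set T) : \bar R :=
  ereal_inf [set (\sum_(0 <= i <oo) (diameter (U i) `^ s))%E
            | U in [set U | delta_cover delta A U]].

(* The premeasure is nonincreasing in delta, so this supremum is its limit as
   delta tends to 0 from the right. *)
Definition hausdorff_measure (s : R) (A : set T) : \bar R :=
  ereal_sup [set hausdorff_premeasure s delta A | delta in [set delta | 0 < delta]].

(* Only s > 0 is used: this avoids the convention for 0 `^ 0 and does not
   change the infimum. *)
Definition hausdorff_dim (A : set T) : \bar R :=
  ereal_inf [set s%:E | s in [set s : R | 0 < s /\ hausdorff_measure s A = 0%E]].

End hausdorff_dimension.

Section weyl_sums.
Context {R : realType}.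

Definition euclidean_dist (d : nat) (x y : 'rV[R]_d) : R :=
  Num.sqrt (\sum_(i < d) (x 0 i - y 0 i) ^+ 2).

Definition real_dist (x y : R) : R := `|x - y|.

Definition torus (d : nat) : set 'rV[R]_d :=
  [set x | forall i, 0 <= x 0 i < 1].

Definition torus1 : set R := [set x | 0 <= x < 1].

(* exp(2 pi i x) *)
Definition e (x : R) : R[i] := cos (2 * pi * x) +i* sin (2 * pi * x).

(* The coordinate x 0 i, with i counted from 0, is the coefficient of n^(i+1). *)
Definition weyl_sum (d : nat) (x : 'rV[R]_d) (N : nat) : R[i] :=
  \sum_(1 <= n < N.+1) e (\sum_(i < d) x 0 i * n%:R ^+ i.+1).

Definition gauss_sum (d : nat) (x : R) (N : nat) : R[i] :=
  \sum_(1 <= n < N.+1) e (x * n%:R ^+ d).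

(* The lower limits are taken in the extended reals: the real-valued limn_inf
   has a default value when the lower limit is +oo. *)
Definition Z_W (d : nat) : set 'rV[R]_d :=
  [set x | torus x /\
     limn_einf (fun N => (ComplexField.Normc.normc (weyl_sum x N))%:E) = 0%E].

Definition Z_G (d : nat) : set R :=
  [set x | torus1 x /\
     limn_einf (fun N => (ComplexField.Normc.normc (gauss_sum d x N))%:E) = 0%E].

End weyl_sums.

Arguments torus {R} d.
Arguments Z_W R d : clear implicits.
Arguments Z_G R d : clear implicits.

(* Main.v *)
(* Let p be an odd prime in (Q, 2Q] and a odd. The shift n -> n + p flips the sign of
   e(a n^d / 2p), so the complete sum over q = 2p terms vanishes; the same holds for
   e(b n / p + a n^2 / 2p). By orthogonality the partial sums of length M < q have
   square mean O(q) over a (resp. over b), so outside a small proportion of fractions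
   summation by parts bounds the sum of q terms at distance r from the fraction by
   O(r q^(d + 1/2)). Points lying within Q^(- tau), tau > d + 1/2, of such fractions for
   infinitely many scales Q therefore belong to the set, and there are Q^(2 - o(1))
   (resp. Q^(3 - o(1))) well separated fractions at scale Q, by a Chebyshev bound for
   primes. Given a cover with small s-dimensional sum, s < 2 / tau (resp. 3 / tau), nested
   balls around fractions are chosen one after the other so as to avoid the cover: an
   averaging over the children replaces the mass distribution principle. *)

Require Import Defs.
From mathcomp Require Import all_boot all_order all_algebra.
From mathcomp Require Import complex.
From mathcomp Require Import all_classical all_reals all_analysis.
From mathcomp Require Import zify ring lra.

Set Implicit Arguments.
Unset Strict Implicit.
Unset Printing Implicit Defensive.

Import Order.TTheory GRing.Theory Num.Theory.
Import numFieldNormedType.Exports.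

(** * Primes in dyadic blocks *)

(** The complete sum vanishes exactly at the fraction only; off the fraction, summation by parts
    brings in every incomplete sum of length below q. A square mean of these over their length is
    enough, so no bound valid for each single length is sought. For the Weyl sums only the
    coefficients of n and n^2 vary and the others are 0: the sum is then quadratic whatever d is,
    [tau] may approach 5 / 2, and the value 3 / (5 / 2) = 6 / 5 does not depend on d. Both
    coordinates share the prime p, hence Q^3 and not Q^4 centres. For a single coefficient of degree
    d the value is 2 / (d + 1 / 2) = 4 / (2 d + 1). Each step uses one scale Q, chosen after the
    parent ball, so that every constant depending on the parent radius, the step or d is below a
    small power of Q. The exponents keep a gap [2 * eps]: one [eps] for such constants and one for
    the shortage of primes. Only arbitrarily large Q are required, not all large Q, which is why an
    elementary count of primes suffices. *)

Lemma pfactor_binom_le (n p : nat) : (0 < n)%N -> prime p ->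
  (p ^ logn p 'C(n.*2, n) <= n.*2)%N.
Proof.
move=> n0 pp.
have pgt1 := prime_gt1 pp.
have bin : ('C(n.*2, n) * (n`! * n`!) = (n.*2)`!)%N.
  by rewrite -addnn; have := bin_fact (leq_addl n n); rewrite addnK.
have bg : (0 < 'C(n.*2, n))%N by rewrite bin_gt0 -addnn leq_addl.
have Hl : (logn p 'C(n.*2, n) + (logn p n`! + logn p n`!) = logn p (n.*2)`!)%N.
  by rewrite -bin !lognM ?muln_gt0 ?fact_gt0 ?bg.
have n20 : (0 < n.*2)%N by rewrite double_gt0.
set L := trunc_log p n.*2.
(* Legendre's formula, padded with terms that vanish because p^k > n for k > n, so that the sums for
   n! and (2n)! have the same range. *)
have wide : logn p n`! = (\sum_(1 <= k < n.*2.+1) n %/ p ^ k)%N.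
  rewrite logn_fact // [RHS](big_cat_nat (n := n.+1)) //=; last by rewrite -addnn; lia.
  rewrite [X in (_ + X)%N]big_nat_cond [X in (_ + X)%N]big1 ?addn0 // => i /andP[/andP[h _] _].
  by apply: divn_small; apply: leq_trans (ltn_expl _ pgt1); rewrite ltnS ltnW.
have wide2 : logn p (n.*2)`! = (\sum_(1 <= k < n.*2.+1) n.*2 %/ p ^ k)%N.
  by rewrite logn_fact.
(* Doubling a quotient carries at most 1, and nothing is left once p^k exceeds 2n; hence the
   exponent in the binomial coefficient is at most [L]. *)
have step k : (n.*2 %/ p ^ k <= n %/ p ^ k + n %/ p ^ k + (k <= L))%N.
  have pk : (0 < p ^ k)%N by rewrite expn_gt0 ltnW.
  case: (leqP k L) => hk.
    have := leq_divDl (p ^ k) n n; rewrite addnn; lia.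
  rewrite divn_small //; apply: (leq_trans (trunc_log_ltn n.*2 pgt1)).
  by rewrite leq_exp2l.
have Lle : (L <= n.*2)%N.
  exact: leq_trans (ltnW (ltn_expl _ pgt1)) (trunc_logP pgt1 n20).
have : (logn p (n.*2)`! <= logn p n`! + logn p n`! + L)%N.
  rewrite wide2 wide -!big_split /=.
  have h : (\sum_(1 <= k < n.*2.+1) n.*2 %/ p ^ k <=
      \sum_(1 <= k < n.*2.+1) (n %/ p ^ k + n %/ p ^ k + (k <= L)))%N.
    by apply: leq_sum => k _; apply: step.
  apply: leq_trans h _.
  rewrite big_split /= leq_add2l.
  rewrite (big_cat_nat (n := L.+1)) //= [X in (_ + X)%N]big_nat_cond [X in (_ + X)%N]big1.
    rewrite addn0; apply: (@leq_trans (\sum_(1 <= k < L.+1) 1)%N).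
      by apply: leq_sum => k _; case: (k <= L)%N.
    by rewrite sum_nat_const_nat muln1 subSS subn0.
  by move=> i /andP[/andP[h _] _]; rewrite leqNgt h.
move=> H; have {}H : (logn p 'C(n.*2, n) <= L)%N by lia.
apply: leq_trans (trunc_logP pgt1 n20).
by rewrite leq_exp2l.
Qed.

(** Each prime power of the factorization is at most 2n, and so is each prime that occurs. Together
    with [two_exp_le_binom] this is Chebyshev's lower bound for the number of primes up to 2n. *)
Lemma binom_le_pi (n : nat) : (0 < n)%N ->
  ('C(n.*2, n) <= n.*2 ^ size [seq p <- iota 0 n.*2.+1 | prime p])%N.
Proof.
move=> n0.
have bg : (0 < 'C(n.*2, n))%N by rewrite bin_gt0 -addnn leq_addl.
rewrite {1}(prod_prime_decomp bg) prime_decompE big_map /=.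
have -> : (n.*2 ^ size [seq p <- iota 0 n.*2.+1 | prime p] =
   \prod_(p <- [seq p <- iota 0 n.*2.+1 | prime p]) n.*2)%N.
  by rewrite big_const_seq count_predT iter_muln_1.
have sub : {subset primes 'C(n.*2, n) <= [seq p <- iota 0 n.*2.+1 | prime p]}.
  move=> p; rewrite mem_primes mem_filter mem_iota => /and3P[pp _ pd].
  rewrite pp /= add0n ltnS; apply: leq_trans (pfactor_binom_le n0 pp).
  rewrite -{1}(expn1 p) leq_exp2l ?prime_gt1 //.
  by rewrite logn_gt0 mem_primes pp bg pd.
apply: leq_trans (_ : \prod_(p <- primes 'C(n.*2, n)) n.*2 <= _)%N.
  rewrite big_seq [X in (_ <= X)%N]big_seq.
  apply: leq_prod => p; rewrite mem_primes => /and3P[pp _ _].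
  exact: pfactor_binom_le.
rewrite !big_const_seq !count_predT !iter_muln_1 leq_exp2l; last by lia.
by apply: uniq_leq_size => //; apply: primes_uniq.
Qed.

Lemma two_exp_le_binom n : (2 ^ n <= 'C(n.*2, n))%N.
Proof.
elim: n => [|n IH]; first by rewrite bin0.
rewrite doubleS binS expnS mul2n -addnn.
have h : ('C(n.*2, n) <= 'C(n.*2.+1, n))%N by case: {IH}n => // n; rewrite binS leq_addr.
have h2 : ('C(n.*2, n) <= 'C(n.*2.+1, n.+1))%N by rewrite binS leq_addl.
by apply: leq_add; [apply: leq_trans h2| apply: leq_trans h].
Qed.

Local Open Scope classical_set_scope.
Local Open Scope complex_scope.
Local Open Scope ring_scope.

Local Notation normc := ComplexField.Normc.normc.

Definition primes_in (Q : nat) : seq nat := [seq p <- iota Q.+1 Q | prime p].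

Lemma mem_primes_in Q p : (p \in primes_in Q) = prime p && (Q < p <= Q.*2)%N.
Proof. by rewrite mem_filter mem_iota -addnn addSn ltnS. Qed.

Lemma pi_dyadic j :
  size [seq p <- iota 0 (2 ^ j).+1 | prime p] = (\sum_(i < j) size (primes_in (2 ^ i)))%N.
Proof.
elim: j => [|j IH]; first by rewrite big_ord0.
rewrite big_ord_recr /= -IH /primes_in -size_cat -filter_cat.
by rewrite -[iota (2 ^ j).+1 _]/(iota (0 + (2 ^ j).+1) _) -iotaD addSn addnn -mul2n -expnS.
Qed.

Lemma bernoulli (R : realDomainType) (t : R) n : 0 <= t -> 1 + n%:R * t <= (1 + t) ^+ n.
Proof.
move=> t0; elim: n => [|n IH]; first by rewrite expr0 mul0r addr0.
rewrite exprS; apply: le_trans (_ : (1 + t) * (1 + n%:R * t) <= _); last first.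
  by apply: ler_wpM2l => //; rewrite addr_ge0.
rewrite -natr1; have : 0 <= n%:R * t * t by rewrite !mulr_ge0.
nra.
Qed.

(** With y = z^3 and t = z - 1, Bernoulli's inequality gives y^j >= (j t)^3, and a cube outgrows a
    square. *)
Lemma expr_beats_square (R : realType) (y C : R) : 1 < y -> 0 < C ->
  exists j : nat, (0 < j)%N /\ C * j%:R ^+ 2 < y ^+ j.
Proof.
move=> y1 C0; set z := y `^ 3^-1.
have y0 : 0 < y by rewrite (lt_trans _ y1).
have z3 : y = z ^+ 3.
  by rewrite /z -powR_mulrn ?powR_ge0// -powRrM mulVf // powRr1 // ltW.
have z1 : 1 < z.
  rewrite ltNge; apply/negP => zle; move: y1; rewrite ltNge z3 => /negP; apply.
  by rewrite exprn_ile1 // powR_ge0.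
pose t := z - 1; have t0 : 0 < t by rewrite subr_gt0.
have [j hj] : exists j : nat, C / t ^+ 3 < j%:R.
  by exists (Num.Def.archi_bound (C / t ^+ 3)); rewrite archi_boundP // divr_ge0 ?exprn_ge0 // ltW.
exists j; rewrite ltr_pdivrMr ?exprn_gt0 // in hj; split.
  by rewrite lt0n; apply/negP => /eqP j0; move: hj; rewrite j0 mul0r ltNge ltW.
have j0 : 0 < j%:R :> R.
  have := lt_trans C0 hj; by rewrite pmulr_lgt0 // exprn_gt0.
apply: lt_le_trans (_ : (j%:R * t ^+ 3) * j%:R ^+ 2 <= _).
  by rewrite ltr_pM2r // exprn_gt0.
rewrite z3 -exprM mulnC exprM.
have B : j%:R * t <= z ^+ j.
  have := @bernoulli R t j (ltW t0); have -> : 1 + t = z by rewrite /t; ring.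
  by apply: le_trans; rewrite lerDr.
have -> : j%:R * t ^+ 3 * j%:R ^+ 2 = (j%:R * t) ^+ 3 by ring.
by rewrite lerXn2r ?nnegrE ?mulr_ge0 ?exprn_ge0 ?powR_ge0 // ltW.
Qed.

Lemma powR_nat_unbounded (R : realType) (a C : R) : 0 < a ->
  exists N : nat, forall Q : nat, (N <= Q)%N -> C <= Q%:R `^ a.
Proof.
move=> a0; exists (Num.Def.archi_bound (`|C| `^ a^-1)) => Q hQ.
apply: le_trans (ler_norm C) _.
have -> : `|C| = (`|C| `^ a^-1) `^ a by rewrite -powRrM mulVf ?gt_eqF // powRr1.
apply: ge0_ler_powR; rewrite ?nnegrE ?powR_ge0 ?ler0n //; first exact: ltW.
apply: le_trans (ltW (archi_boundP _)) _; first exact: powR_ge0.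
by rewrite ler_nat.
Qed.

(** By contradiction: if every block (2^i, 2^(i+1)] with i >= N were poor in primes, adding up the
    blocks below 2^j would leave at most j 2^N 2^(j (1 - eps)) primes, against the Chebyshev count
    of at least 2^(j - 1) / j. *)
Lemma many_primes_in (R : realType) (eps : R) (N : nat) : 0 < eps ->
  exists Q : nat, [/\ (N <= Q)%N, (0 < Q)%N &
    Q%:R `^ (1 - eps) <= (size (primes_in Q))%:R].
Proof.
move=> e0.
wlog e1 : eps e0 / eps <= 1.
  move=> H; have [le|gt] := leP eps 1; first exact: H.
  have [Q [h1 h2 h3]] := H 1 ltr01 (lexx _); exists Q; split => //.
  by apply: le_trans h3; apply: ler_powR; [rewrite ler1n | lra].
apply: contrapT => /forallNP H.
have {}H i : (N <= i)%N -> (size (primes_in (2 ^ i)))%:R <= (2 ^ i)%:R `^ (1 - eps) :> R.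
  move=> Ni; rewrite leNgt; apply/negP => h; apply: (H (2 ^ i)%N); split.
  - by apply: leq_trans Ni _; rewrite ltnW // ltn_expl.
  - by rewrite expn_gt0.
  - exact: ltW.
pose y : R := 2 `^ eps.
have y1 : 1 < y.
  by rewrite /y /powR pnatr_eq0 /= expR_gt1 mulr_gt0 // ln_gt0 // ltr1n.
have C0 : 0 < 2 ^+ N * 2 * 2 :> R by rewrite !mulr_gt0 ?exprn_gt0.
have [j [j0 hj]] := expr_beats_square y1 C0.
(* Blocks below N are counted trivially; the factor 2^N pays for them. *)
have bnd i : (i < j)%N ->
    (size (primes_in (2 ^ i)))%:R <= 2 ^+ N * ((2 ^ j)%:R `^ (1 - eps)) :> R.
  move=> ij; have [Ni|iN] := leqP N i.
    apply: le_trans (H _ Ni) _.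
    apply: le_trans (_ : (2 ^ j)%:R `^ (1 - eps) <= _).
      apply: ge0_ler_powR; rewrite ?nnegrE ?ler0n ?subr_ge0 //.
      by rewrite ler_nat leq_exp2l // ltnW.
    by rewrite ler_peMl ?powR_ge0 // exprn_ege1 // ler1n.
  apply: le_trans (_ : 2 ^+ N <= _).
    rewrite -natrX ler_nat size_filter; apply: leq_trans (count_size _ _) _.
    by rewrite size_iota leq_exp2l // ltnW.
  rewrite ler_peMr ?exprn_ge0 //.
  rewrite -[X in X <= _](powRr0 (2 ^ j)%:R); apply: ler_powR; last by rewrite subr_ge0.
  by rewrite ler1n expn_gt0.
have pi : (size [seq p <- iota 0 (2 ^ j).+1 | prime p])%:R <=
    j%:R * (2 ^+ N * ((2 ^ j)%:R `^ (1 - eps))) :> R.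
  rewrite pi_dyadic natr_sum.
  apply: le_trans (_ : \sum_(i < j) (2 ^+ N * ((2 ^ j)%:R `^ (1 - eps))) <= _).
    by apply: ler_sum => i _; apply: bnd.
  by rewrite sumr_const card_ord -[X in X <= _]mulr_natl.
(* Chebyshev at n = 2^(j - 1), where 2n = 2^j: both sides are powers of 2 and their exponents are
   compared. *)
have : (2 ^ j.-1 <= j * size [seq p <- iota 0 (2 ^ j).+1 | prime p])%N.
  have e : (2 ^ j.-1).*2 = (2 ^ j)%N by rewrite -mul2n -expnS prednK.
  have := @binom_le_pi (2 ^ j.-1) ltac:(by rewrite expn_gt0).
  move/(leq_trans (two_exp_le_binom _)).
  by rewrite e -expnM leq_exp2l.
move: pi; set P := size _ => pi; rewrite -(ler_nat R) natrM => up.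
have : (2 ^ j)%:R <= 2 * (j%:R * (j%:R * (2 ^+ N * (2 ^ j)%:R `^ (1 - eps)))) :> R.
  rewrite -{1}(prednK j0) expnS natrM ler_pM2l //; apply: le_trans up _.
  by rewrite ler_wpM2l.
have pos : 0 < (2 ^ j)%:R `^ (1 - eps) :> R by rewrite powR_gt0 // ltr0n expn_gt0.
have E2 : (2 ^ j)%:R = y ^+ j * (2 ^ j)%:R `^ (1 - eps) :> R.
  have -> : y ^+ j = (2 ^ j)%:R `^ eps.
    rewrite /y -powR_mulrn ?powR_ge0 // -powRrM mulrC powRrM powR_mulrn //.
    by rewrite natrX.
  rewrite -powRD; last by rewrite addrC subrK oner_eq0.
  by rewrite addrC subrK powRr1.
have -> : 2 * (j%:R * (j%:R * (2 ^+ N * (2 ^ j)%:R `^ (1 - eps)))) =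
  (2 ^+ N * 2 * j%:R ^+ 2) * (2 ^ j)%:R `^ (1 - eps) :> R by ring.
rewrite [X in X <= _]E2 ler_pM2r // leNgt => /negP; apply; apply: le_lt_trans hj.
have : 0 <= 2 ^+ N * 2 * j%:R ^+ 2 :> R by rewrite !mulr_ge0 ?exprn_ge0.
lra.
Qed.

(** * Exponential sums *)

Section exponential_sums.
Context {R : realType}.
Implicit Types (x y : R) (z : R[i]).

Lemma complex_ext z z' : complex.Re z = complex.Re z' -> complex.Im z = complex.Im z' -> z = z'.
Proof. by case: z z' => [a b] [c d] /= -> ->. Qed.

Lemma e_add x y : e (x + y) = e x * e y.
Proof.
by apply: complex_ext; rewrite /= mulrDr ?cosD ?sinD // addrC [X in _ + X]mulrC.
Qed.

Lemma e0 : e 0 = 1 :> R[i].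
Proof. by apply: complex_ext; rewrite /= mulr0 ?cos0 ?sin0. Qed.

Lemma e1 : e 1 = 1 :> R[i].
Proof.
by apply: complex_ext; rewrite /= mulr1 mulrC mulr_natr ?cos2pi ?sin2pi.
Qed.

Lemma e_nat n : e n%:R = 1 :> R[i].
Proof. by elim: n => [|n IH]; rewrite ?e0 // -natr1 e_add IH e1 mulr1. Qed.

Lemma e_half : e (2^-1) = -1 :> R[i].
Proof.
apply: complex_ext; rewrite /= mulrAC divff ?pnatr_eq0 // mul1r ?cospi ?sinpi //.
by rewrite oppr0.
Qed.

Lemma e_opp x : e (- x) * e x = 1.
Proof. by rewrite -e_add addNr e0. Qed.

Lemma e_natMl x n : e (n%:R * x) = e x ^+ n.
Proof.
elim: n => [|n IH]; first by rewrite mul0r e0.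
by rewrite -natr1 mulrDl mul1r e_add IH exprSr.
Qed.

Lemma normc_e x : normc (e x) = 1.
Proof. by rewrite /= cos2Dsin2 sqrtr1. Qed.

Lemma e_neq1 x : 0 < x < 1 -> e x != 1.
Proof.
move=> /andP[x0 x1]; apply/eqP => /(congr1 (@complex.Re R)) /= h.
have s : 0 < sin (pi * x).
  by apply: sin_gt0_pi; rewrite mulr_gt0 ?pi_gt0 //= gtr_pMr ?pi_gt0.
have : cos (2 * pi * x) = 1 - sin (pi * x) ^+ 2 *+ 2.
  have -> : 2 * pi * x = (pi * x) *+ 2 by ring.
  rewrite cos_mulr2n sin2cos2; ring.
rewrite h => h2.
have : 0 < sin (pi * x) ^+ 2 by rewrite exprn_gt0.
lra.
Qed.

Lemma normc_ge0 z : 0 <= normc z.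
Proof. by case: z => a b /=; apply: sqrtr_ge0. Qed.

Lemma normc_add z z' : normc (z + z') <= normc z + normc z'.
Proof. exact: (@le_normcD R z z'). Qed.

Lemma normc_opp z : normc (- z) = normc z.
Proof. exact: (@normcN R z). Qed.

Lemma normc_sum (I : Type) (r : seq I) (P : pred I) (F : I -> R[i]) :
  normc (\sum_(i <- r | P i) F i) <= \sum_(i <- r | P i) normc (F i).
Proof.
elim/big_rec2: _ => [|i b a _ h]; first by rewrite ComplexField.Normc.normc0.
by apply: le_trans (normc_add _ _) _; rewrite lerD2l.
Qed.

Lemma cos_lip x y : `|cos x - cos y| <= `|x - y|.
Proof.
wlog h : x y / y <= x.
  move=> H; have [|/ltW] := leP y x; first exact: H.
  by move=> /H; rewrite distrC [`|y - x|]distrC.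
have [c _ ->] := @MVT_segment R cos (fun u => - sin u) y x h
   (fun u _ => is_derive_cos u) (continuous_subspaceT (@continuous_cos R)).
by rewrite normrM normrN ler_piMl // sin_max.
Qed.

Lemma sin_lip x y : `|sin x - sin y| <= `|x - y|.
Proof.
wlog h : x y / y <= x.
  move=> H; have [|/ltW] := leP y x; first exact: H.
  by move=> /H; rewrite distrC [`|y - x|]distrC.
have [c _ ->] := @MVT_segment R sin cos y x h
   (fun u _ => is_derive_sin u) (continuous_subspaceT (@continuous_sin R)).
by rewrite normrM ler_piMl // cos_max.
Qed.

(** The constant is crude: 2 pi <= 8, and real and imaginary parts are estimated separately and
    added. *)
Lemma e_lip x y : normc (e x - e y) <= 16 * `|x - y|.
Proof.
rewrite /=.
set a := cos _ - cos _; set b := sin _ - sin _.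
have d : `|2 * pi * x - 2 * pi * y| <= 8 * `|x - y|.
  rewrite -mulrBr normrM ler_wpM2r // normrM [`|pi|]ger0_norm ?pi_ge0 // normr_nat.
  have := @pihalf_lt2 R; lra.
have ha : `|a| <= 8 * `|x - y| by apply: le_trans (cos_lip _ _) d.
have hb : `|b| <= 8 * `|x - y| by apply: le_trans (sin_lip _ _) d.
apply: le_trans (_ : `|a| + `|b| <= _); last by lra.
rewrite -[X in _ <= X]ger0_norm ?addr_ge0 // -sqrtr_sqr ler_wsqrtr //.
rewrite -[a ^+ 2]real_normK ?num_real // -[b ^+ 2]real_normK ?num_real //.
have := mulr_ge0 (normr_ge0 a) (normr_ge0 b); nra.
Qed.

Definition exp_sum (g : nat -> R) (M : nat) : R[i] := \sum_(1 <= n < M.+1) e (g n).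

Lemma exp_sumS g M : exp_sum g M.+1 = exp_sum g M + e (g M.+1).
Proof. by rewrite /exp_sum big_nat_recr. Qed.

Lemma exp_sum0 g : exp_sum g 0 = 0.
Proof. by rewrite /exp_sum big_geq. Qed.

(** Summation by parts, with the twist e(f - g) as the slowly varying weight. *)
Lemma exp_sum_abel (f g : nat -> R) q : exp_sum f q.+1 =
  e (f q.+1 - g q.+1) * exp_sum g q.+1 -
  \sum_(1 <= M < q.+1) (e (f M.+1 - g M.+1) - e (f M - g M)) * exp_sum g M.
Proof.
have fg n : e (f n) = e (f n - g n) * e (g n) by rewrite -e_add subrK.
elim: q => [|q IH].
  by rewrite !exp_sumS !exp_sum0 !add0r big_geq // subr0 -fg.
rewrite exp_sumS IH (exp_sumS g q.+1) [\sum_(1 <= M < q.+2) _]big_nat_recr //= fg.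
ring.
Qed.

Lemma exp_sum_perturb (f g : nat -> R) q (L : R) :
  (forall n, (0 < n < q)%N -> `|(f n.+1 - g n.+1) - (f n - g n)| <= L) ->
  normc (exp_sum f q) <= normc (exp_sum g q) + 16 * L * \sum_(1 <= M < q) normc (exp_sum g M).
Proof.
case: q => [|q] H.
  by rewrite !exp_sum0 ComplexField.Normc.normc0 big_geq // mulr0 addr0.
rewrite (exp_sum_abel f g); apply: le_trans (normc_add _ _) _.
rewrite ComplexField.Normc.normcM normc_e mul1r normc_opp lerD2l.
apply: le_trans (normc_sum _ _ _) _.
rewrite mulr_sumr big_nat_cond [X in _ <= X]big_nat_cond.
apply: ler_sum => M /andP[/andP[M1 M2] _].
rewrite ComplexField.Normc.normcM ler_wpM2r ?normc_ge0 //.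
apply: le_trans (e_lip _ _) _; rewrite ler_pM2l //.
by apply: H; rewrite M1.
Qed.

Lemma exp_sum_antiperiodic (g : nat -> R) p :
  (forall n, e (g (n + p)%N) = - e (g n)) -> exp_sum g p.*2 = 0.
Proof.
move=> H; rewrite /exp_sum (big_cat_nat (n := p.+1)) //=; last by rewrite ltnS -addnn leq_addr.
have -> : \sum_(p.+1 <= n < p.*2.+1) e (g n) = \sum_(1 <= n < p.+1) e (g (n + p)%N).
  by rewrite -{1}[p.+1]add1n big_addn -addnn -addSn addnK.
by rewrite (eq_bigr _ (fun n _ => H n)) sumrN subrr.
Qed.

Lemma e_frac_neq1 (h k q : nat) : (0 < q)%N -> h != k %[mod q] ->
  e ((h%:R - k%:R) / q%:R) != 1 :> R[i].
Proof.
move=> q0; wlog kh : h k / (k <= h)%N.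
  move=> H hk; have [|/ltnW] := leqP k h; first by move=> ?; exact: H.
  move=> /H; rewrite eq_sym => /(_ hk); apply: contra => /eqP h1.
  have := e_opp ((h%:R - k%:R) / q%:R); rewrite h1 mulr1 => <-.
  by rewrite -mulNr opprB.
move=> hk; rewrite -natrB //.
rewrite {1}(divn_eq (h - k) q) natrD natrM mulrDl mulfK ?pnatr_eq0 -?lt0n //.
rewrite e_add e_nat mul1r; apply: e_neq1.
rewrite divr_gt0 ?ltr0n //=; last first.
  by rewrite lt0n -[_ == 0%N]/(q %| h - k)%N -eqn_mod_dvd.
by rewrite ltr_pdivrMr ?ltr0n // mul1r ltr_nat ltn_mod.
Qed.

Lemma e_frac_sum (h k q : nat) (c : R) : (0 < q)%N -> h != k %[mod q] ->
  \sum_(0 <= a < q) e (c + a%:R * ((h%:R - k%:R) / q%:R)) = 0 :> R[i].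
Proof.
move=> q0 hk; set x := _ / _.
under eq_bigr do rewrite e_add e_natMl.
rewrite -mulr_sumr; apply/eqP; rewrite mulf_eq0; apply/orP; right.
have h1 := e_frac_neq1 q0 hk; rewrite -/x in h1.
rewrite -(mulrI_eq0 _ (mulfI (_ : e x - 1 != 0))) ?subr_eq0 //.
rewrite big_mkord -subrX1 subr_eq0 -e_natMl /x mulrCA divff ?pnatr_eq0 -?lt0n // mulr1.
have := e_add (h%:R - k%:R) k%:R; rewrite subrK !e_nat mulr1 => <-.
by [].
Qed.

Lemma normc_exp_sum_sqr (g : nat -> R) M : normc (exp_sum g M) ^+ 2 =
  \sum_(1 <= m < M.+1) \sum_(1 <= n < M.+1) cos (2 * pi * (g m - g n)).
Proof.
have -> : exp_sum g M = (\sum_(1 <= n < M.+1) cos (2 * pi * g n)) +i*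
    (\sum_(1 <= n < M.+1) sin (2 * pi * g n)).
  rewrite /exp_sum; elim/big_rec3: _ => //= i a b c _ ->.
  by apply: complex_ext.
rewrite /= sqr_sqrtr ?addr_ge0 ?sqr_ge0 // !expr2 !mulr_suml -big_split /=.
apply: eq_bigr => m _; rewrite !mulr_sumr -big_split /=.
by apply: eq_bigr => n _; rewrite mulrBr cosB.
Qed.

Lemma Re_sum (I : Type) (r : seq I) (F : I -> R[i]) :
  complex.Re (\sum_(i <- r) F i) = \sum_(i <- r) complex.Re (F i).
Proof. by elim/big_rec2: _ => //= i a b _ <-; case: (F i) b => ? ? []. Qed.

(** After expanding the square and summing over a first, the pairs (m, n) with h m and h n
    incongruent cancel by [e_frac_sum]; each of the at most M c other pairs contributes at most q.
    The free part [g] lets one coefficient of a Weyl sum be averaged while the other stays fixed. *)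
Lemma exp_sum_mean_square (q c M : nat) (h : nat -> nat) (g : nat -> R) : (0 < q)%N ->
  (forall m, (0 < m <= M)%N ->
    (size [seq n <- index_iota 1 M.+1 | h m == h n %[mod q]] <= c)%N) ->
  \sum_(0 <= a < q)
    normc (exp_sum (fun n => g n + a%:R * ((h n)%:R / q%:R)) M) ^+ 2 <= (q * (M * c))%:R.
Proof.
move=> q0 H; under eq_bigr do rewrite normc_exp_sum_sqr.
rewrite exchange_big /=.
apply: le_trans (_ : \sum_(1 <= m < M.+1) (q * c)%:R <= _); last first.
  by rewrite sumr_const_nat subSS subn0 -[X in X <= _]mulr_natr -natrM mulnAC mulnA.
rewrite big_nat_cond [X in _ <= X]big_nat_cond.
apply: ler_sum => m /andP[/andP[m1 m2] _].
rewrite exchange_big /=.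
apply: le_trans (_ : \sum_(1 <= n < M.+1) (q * (h m == h n %[mod q]))%:R <= _); last first.
  rewrite -natr_sum ler_nat -big_distrr /= leq_mul2l; apply/orP; right.
  by rewrite -big_mkcond /= sum1_count -size_filter H // m1.
apply: ler_sum => n _.
have [hh|hh] := boolP (h m == h n %[mod q]).
  apply: le_trans (_ : \sum_(0 <= a < q) 1 <= _); first by apply: ler_sum => a _; apply: cos_le1.
  by rewrite sumr_const_nat subn0 muln1.
rewrite muln0 -[X in _ <= X]/(complex.Re (0 : R[i])).
rewrite -(e_frac_sum (g m - g n) q0 hh) Re_sum; apply: ler_sum => a _ /=.
rewrite le_eqVlt; apply/orP; left; apply/eqP; congr (cos (_ * _)); ring.
Qed.

End exponential_sums.

(** * Fractions with small partial sums *)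

(** The solutions are roots of X^d - m^d over the field with p elements, and p consecutive integers
    represent distinct residues. *)
Lemma power_residue_count_block (p d m s : nat) : prime p -> (0 < d)%N ->
  (size [seq n <- iota s p | m ^ d == n ^ d %[mod p]] <= d)%N.
Proof.
move=> pp d0; pose P : {poly 'F_p} := 'X^d - ((m ^ d)%:R)%:P.
have nat_eq a b : (a%:R == b%:R :> 'F_p) = (a == b %[mod p]).
  by rewrite -val_eqE /= !val_Fp_nat.
set l := [seq n <- _ | _].
have sz : size P = d.+1 by rewrite size_XnsubC.
rewrite -ltnS -sz -(size_map (fun n => n%:R : 'F_p)); apply: max_poly_roots.
- by rewrite -size_poly_eq0 sz.
- apply/allP => x /mapP[n]; rewrite mem_filter => /andP[h _] ->.
  by rewrite rootE !hornerE subr_eq0 -natrX nat_eq eq_sym.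
- rewrite map_inj_in_uniq; first by rewrite filter_uniq // iota_uniq.
  move=> n n'; rewrite !mem_filter !mem_iota => /andP[_ h1] /andP[_ h2] /eqP.
  rewrite nat_eq => e.
  wlog le : n n' h1 h2 e / (n <= n')%N.
    move=> H; case/orP: (leq_total n n') => le; first exact: H.
    by apply/esym; apply: H => //; rewrite eq_sym.
  move: e; rewrite eq_sym eqn_mod_dvd // => dv.
  have : (n' - n = 0)%N.
    by apply/eqP; apply: contraTT dv; rewrite -lt0n => gt; rewrite gtnNdvd //; lia.
  lia.
Qed.

(** A congruence modulo 2p implies one modulo p, and 1, ..., 2p consists of two blocks of length
    p. *)
Lemma power_residue_count (p d m : nat) : prime p -> (0 < d)%N ->
  (size [seq n <- index_iota 1 p.*2.+1 | m ^ d == n ^ d %[mod p.*2]] <= d.*2)%N.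
Proof.
move=> pp d0.
apply: (@leq_trans (size [seq n <- index_iota 1 p.*2.+1 | m ^ d == n ^ d %[mod p]])).
  rewrite !size_filter; apply: sub_count => n /= /eqP h; apply/eqP.
  by rewrite -(@modn_dvdm p.*2) -?mul2n ?dvdn_mull // mul2n h modn_dvdm // -mul2n dvdn_mull.
rewrite /index_iota subSS subn0 -addnn iotaD filter_cat size_cat -addnn.
by apply: leq_add; apply: power_residue_count_block.
Qed.

Section good_phases.
Context {R : realType}.

(** Square-root cancellation on average over the length: the proper partial sums have size about
    sqrt(K q) in square mean. *)
Definition good_phase (g : nat -> R) (q : nat) (K : R) : bool :=
  \sum_(1 <= M < q) normc (exp_sum g M) ^+ 2 <= K * q%:R ^+ 2.

(** Markov's inequality: the squares summed over all a and M are at most c q^3, and every bad a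
    accounts for more than K q^2 of this. *)
Lemma few_bad_phases (q c : nat) (h : nat -> nat) (g : nat -> R) (K : R) :
  (0 < q)%N -> 0 < K ->
  (forall m, (0 < m <= q)%N ->
    (size [seq n <- index_iota 1 q.+1 | h m == h n %[mod q]] <= c)%N) ->
  (size [seq a <- iota 0 q |
     ~~ good_phase (fun n => g n + a%:R * ((h n)%:R / q%:R)) q K])%:R * K <= (c * q)%:R.
Proof.
move=> q0 K0 H.
pose F a M := normc (exp_sum (fun n => g n + a%:R * ((h n)%:R / q%:R)) M) ^+ 2.
have S1 : \sum_(0 <= a < q) \sum_(1 <= M < q) F a M <= (q * (q * c) * q)%:R.
  rewrite exchange_big /=.
  apply: le_trans (_ : \sum_(1 <= M < q) (q * (q * c))%:R <= _).
    rewrite big_nat_cond [X in _ <= X]big_nat_cond.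
    apply: ler_sum => M /andP[/andP[M1 M2] _].
    apply: le_trans (exp_sum_mean_square g q0 (c := c) (h := h) (M := M) _) _; last first.
      by rewrite ler_nat leq_mul2l leq_mul2r (ltnW M2) !orbT.
    move=> m /andP[m1 m2]; apply: leq_trans (H m _).
      rewrite /index_iota !subSS !subn0 -(subnKC (ltnW M2)) iotaD filter_cat size_cat.
      by rewrite leq_addr.
    by rewrite m1 (leq_trans m2 (ltnW M2)).
  by rewrite sumr_const_nat -[X in X <= _]mulr_natr -natrM ler_nat leq_mul2l leq_subr orbT.
have S2 : (size [seq a <- iota 0 q |
     ~~ good_phase (fun n => g n + a%:R * ((h n)%:R / q%:R)) q K])%:R * (K * q%:R ^+ 2)
     <= \sum_(0 <= a < q) \sum_(1 <= M < q) F a M.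
  rewrite size_filter -sum1_count natr_sum mulr_suml.
  rewrite /index_iota !subn0 big_mkcond; apply: ler_sum => a _.
  case: ifP => [|_]; last by apply: sumr_ge0 => M _; rewrite exprn_ge0 // normc_ge0.
  by rewrite -ltNge mul1r => /ltW.
have q2 : 0 < q%:R ^+ 2 :> R by rewrite exprn_gt0 // ltr0n.
have := le_trans S2 S1; rewrite mulrA.
have -> : (q * (q * c) * q)%:R = (c * q)%:R * q%:R ^+ 2 :> R.
  by rewrite -natrX -natrM; congr _%:R; ring.
by rewrite ler_pM2r.
Qed.

Lemma good_phase_sum (g : nat -> R) q (K : R) : (0 < q)%N -> 0 < K -> good_phase g q K ->
  \sum_(1 <= M < q) normc (exp_sum g M) <= q%:R * Num.sqrt (K * q%:R).
Proof.
move=> q0 K0 G; set l := Num.sqrt _.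
have qR : 0 < q%:R :> R by rewrite ltr0n.
have l0 : 0 < l by rewrite sqrtr_gt0 mulr_gt0.
have l2 : l ^+ 2 = K * q%:R by rewrite sqr_sqrtr // mulr_ge0 // ltW.
rewrite -(ler_pM2l l0) -(@ler_pM2l _ 2) // !mulr_sumr.
(* Cauchy-Schwarz in the form 2 l u <= l^2 + u^2, where l = sqrt(K q) balances both terms. *)
apply: le_trans (_ : \sum_(1 <= M < q) (l ^+ 2 + normc (exp_sum g M) ^+ 2) <= _).
  by apply: ler_sum => M _; have := sqr_ge0 (l - normc (exp_sum g M)); nra.
rewrite big_split /= sumr_const_nat.
have h1 : l ^+ 2 *+ (q - 1) <= l ^+ 2 * q%:R.
  by rewrite -[X in X <= _]mulr_natr ler_pM2l ?exprn_gt0 // ler_nat leq_subr.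
have := lerD h1 G; move=> h; apply: le_trans h _; rewrite l2.
have -> : 2 * (l * (q%:R * l)) = 2 * (l ^+ 2 * q%:R) by ring.
by rewrite l2 le_eqVlt; apply/orP; left; apply/eqP; ring.
Qed.

Lemma expr_succ_sub_le (n d : nat) :
  0 <= (n.+1%:R : R) ^+ d.+1 - n%:R ^+ d.+1 <= d.+1%:R * n.+1%:R ^+ d.
Proof.
rewrite subr_ge0 lerXn2r ?nnegrE ?ler_nat //=.
elim: d => [|d IH]; first by rewrite !expr1 expr0 -natr1; lra.
have h : (n%:R : R) ^+ d.+1 <= n.+1%:R ^+ d.+1 by rewrite lerXn2r ?nnegrE ?ler_nat.
have n0 : 0 <= n%:R :> R by [].
have n1 : 0 <= n.+1%:R :> R by [].
have h2 := ler_wpM2l n1 IH.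
rewrite exprS [n%:R ^+ d.+2]exprS -[d.+2%:R]natr1.
rewrite mulrBr in h2.
have e1 : n.+1%:R * (d.+1%:R * n.+1%:R ^+ d) = d.+1%:R * n.+1%:R ^+ d.+1 :> R.
  by rewrite exprS; ring.
have e2 : n.+1%:R * n%:R ^+ d.+1 = n%:R * n%:R ^+ d.+1 + n%:R ^+ d.+1 :> R.
  by rewrite -{1}natr1; ring.
rewrite e1 e2 in h2; lra.
Qed.

(* For [a] odd, adding the odd number [p] to [n] changes [n ^ d] by an odd multiple of [p]. *)
Lemma e_half_shift (p a d n : nat) : odd p -> odd a -> (0 < d)%N ->
  e (a%:R * (((n + p) ^ d)%:R / p.*2%:R)) = - e (a%:R * ((n ^ d)%:R / p.*2%:R)) :> R[i].
Proof.
move=> op oa d0.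
have p0 : (0 < p)%N by case: p op.
have [k ok hk] : exists2 k, odd k & ((n + p) ^ d = n ^ d + k * p)%N.
  have /dvdnP[k hk] : (p %| (n + p) ^ d - n ^ d)%N.
    by rewrite -eqn_mod_dvd ?leq_exp2r ?leq_addr // -modnXm modnDr modnXm.
  have le : (n ^ d <= (n + p) ^ d)%N by rewrite leq_exp2r ?leq_addr.
  exists k; last by rewrite -hk subnKC.
  have := congr1 odd hk; rewrite oddB // oddM op andbT !oddX oddD op.
  by rewrite -(prednK d0) /=; case: (odd n).
have [j hj] : exists j, (a * k = j.*2.+1)%N.
  exists (a * k)./2; rewrite -[LHS]odd_double_half oddM oa ok; lia.
have pR : p%:R != 0 :> R by rewrite pnatr_eq0 -lt0n.
have -> : a%:R * (((n + p) ^ d)%:R / p.*2%:R) =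
    a%:R * ((n ^ d)%:R / p.*2%:R) + (j%:R + 2^-1) :> R.
  rewrite hk natrD mulrDl mulrDr; congr (_ + _).
  rewrite natrM -muln2 natrM invfM.
  have -> : a%:R * (k%:R * p%:R * (p%:R^-1 / 2)) = (a * k)%:R / 2 :> R.
    by rewrite natrM; field.
  by rewrite hj -natr1 -muln2 natrM; field.
by rewrite e_add e_add e_nat e_half mul1r mulrN1.
Qed.

(** The full sum of [g] vanishes by antiperiodicity, so only the second term of [exp_sum_perturb]
    survives. Here [d] is the degree minus one, and for fixed d and K the bound is of order r q^(d +
    3 / 2). *)
Lemma near_good_bound (f g : nat -> R) (p q d : nat) (r K : R) :
  q = p.*2 -> (0 < q)%N -> 0 < K -> good_phase g q K ->
  (forall n, e (g (n + p)%N) = - e (g n)) ->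
  (forall n, (0 < n < q)%N ->
     `|(f n.+1 - g n.+1) - (f n - g n)| <= r * (d.+1%:R * n.+1%:R ^+ d)) ->
  0 <= r ->
  normc (exp_sum f q) <= 16 * (r * (d.+1%:R * q%:R ^+ d)) * (q%:R * Num.sqrt (K * q%:R)).
Proof.
move=> qp q0 K0 G anti H r0.
apply: le_trans (exp_sum_perturb (L := r * (d.+1%:R * q%:R ^+ d)) _) _.
  move=> n /[dup] nq /H h; apply: le_trans h _.
  rewrite ler_wpM2l // ler_wpM2l // lerXn2r ?nnegrE ?ler_nat //.
  by case/andP: nq.
rewrite {1}qp exp_sum_antiperiodic // ComplexField.Normc.normc0 add0r.
apply: ler_wpM2l; last exact: good_phase_sum.
by rewrite !mulr_ge0 // exprn_ge0.
Qed.

(** The summand 0 gives the shape of the phases in [few_bad_phases], with [g] = 0. *)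
Definition gauss_phase (d q a : nat) : nat -> R :=
  fun n => 0 + a%:R * ((n ^ d)%:R / q%:R).

(** The quadratic term comes first because it is the fixed [g] of [few_bad_phases]; the average runs
    over the linear numerator [b]. *)
Definition weyl_phase (q a b : nat) : nat -> R :=
  fun n => a%:R * ((n ^ 2)%:R / q%:R) + b%:R * (n%:R / q%:R).

Lemma gauss_near (d p a : nat) (x r K : R) : odd p -> odd a -> 0 < K ->
  good_phase (gauss_phase d.+1 p.*2 a) p.*2 K -> `|x - a%:R / p.*2%:R| <= r ->
  normc (gauss_sum d.+1 x p.*2) <=
    16 * (r * (d.+1%:R * p.*2%:R ^+ d)) * (p.*2%:R * Num.sqrt (K * p.*2%:R)).
Proof.
move=> op oa K0 G xr.
apply: (@near_good_bound _ (gauss_phase d.+1 p.*2 a) p) => //.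
- by rewrite double_gt0; case: p op {G xr}.
- by move=> n; rewrite /gauss_phase !add0r e_half_shift.
- move=> n _; rewrite /gauss_phase !add0r.
  have -> : x * n.+1%:R ^+ d.+1 - a%:R * ((n.+1 ^ d.+1)%:R / p.*2%:R) -
    (x * n%:R ^+ d.+1 - a%:R * ((n ^ d.+1)%:R / p.*2%:R)) =
    (x - a%:R / p.*2%:R) * (n.+1%:R ^+ d.+1 - n%:R ^+ d.+1).
    by rewrite !natrX; ring.
  have /andP[h1 h2] := expr_succ_sub_le n d.
  by rewrite normrM [`|_ ^+ _ - _|]ger0_norm // ler_pM.
- exact: le_trans xr.
Qed.

Lemma weyl_near (p a b : nat) (x y r K : R) : odd p -> odd a -> 0 < K ->
  good_phase (weyl_phase p.*2 a b.*2) p.*2 K ->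
  `|x - b%:R / p%:R| <= r -> `|y - a%:R / p.*2%:R| <= r ->
  normc (exp_sum (fun n => x * n%:R + y * n%:R ^+ 2) p.*2) <=
    16 * (r * (2 * p.*2%:R ^+ 1)) * (p.*2%:R * Num.sqrt (K * p.*2%:R)).
Proof.
move=> op oa K0 G xr yr.
have p0 : (0 < p)%N by case: p op {G xr yr}.
have pR : p%:R != 0 :> R by rewrite pnatr_eq0 -lt0n.
apply: (@near_good_bound _ (weyl_phase p.*2 a b.*2) p) => //.
- by rewrite double_gt0.
- move=> n; rewrite /weyl_phase e_add e_half_shift // mulNr; congr (- _).
  rewrite e_add; congr (_ * _).
  (* The linear numerator is even, so the shift by p changes the linear phase by the integer b and
     leaves the sign flip of the quadratic part intact. *)
  have -> : b.*2%:R * ((n + p)%:R / p.*2%:R) = b.*2%:R * (n%:R / p.*2%:R) + b%:R :> R.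
    by rewrite natrD -!muln2 !natrM; field.
  by rewrite e_add e_nat mulr1.
- move=> n /andP[n0 _]; rewrite /weyl_phase.
  (* The increment of the phase error is at most r + r (2 n + 1) = 2 r (n + 1), the hypothesis of
     [near_good_bound] with d = 1. *)
  have -> : x * n.+1%:R + y * n.+1%:R ^+ 2 -
      (a%:R * ((n.+1 ^ 2)%:R / p.*2%:R) + b.*2%:R * (n.+1%:R / p.*2%:R)) -
      (x * n%:R + y * n%:R ^+ 2 -
       (a%:R * ((n ^ 2)%:R / p.*2%:R) + b.*2%:R * (n%:R / p.*2%:R))) =
    (x - b%:R / p%:R) + (y - a%:R / p.*2%:R) * (2 * n%:R + 1).
    by rewrite !natrX -natr1 -!muln2 !natrM; field.
  apply: le_trans (ler_normD _ _) _.
  have n1 : 0 <= 2 * n%:R + 1 :> R by rewrite addr_ge0 // mulr_ge0.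
  rewrite normrM [`|2 * _ + 1|]ger0_norm // expr1.
  have := ler_wpM2r n1 yr; rewrite -[n.+1%:R]natr1; lra.
- exact: le_trans xr.
Qed.

End good_phases.

(** * Cantor schemes and Hausdorff measure *)

Lemma powR_div {R : realType} (x y s : R) : 0 <= x -> 0 <= y ->
  (x / y) `^ s = x `^ s / y `^ s.
Proof.
move=> x0 y0; rewrite powRM ?invr_ge0 //; congr (_ * _).
by rewrite -powR_inv1 // -powRrM mulrC powRrM powR_inv1 ?powR_ge0.
Qed.

Section cantor_scheme.
Context {R : realType} {T : Type} (dist : T -> T -> R) {X : eqType}.
Context (node : X -> Prop) (rho : X -> R) (B : X -> set T) (P : nat -> X -> Prop).
Context (s c0 : R).

Definition hits (U : set T) (C : seq X) : nat := count (fun c => `[< U `&` B c !=set0 >]) C.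

(* The chosen child must avoid every set at least as large as itself, so such a hit has
   weight 1. *)
Definition hit_weight (rho' r : R) : R := if rho' <= r then 1 else (r / rho') `^ s / c0.

Definition diam_le (r : R) (U : set T) : Prop := forall u v, U u -> U v -> dist u v <= r.

(** The last clause stands in for a measure: the weighted proportion of children met by [U] is at
    most half of the s-weight of [U] relative to the parent. Since these s-weights add up to at most
    1 for a [sparse] parent, the average total over the children is at most 1 / 2. *)
Definition spread_children (k : nat) (x : X) (C : seq X) (rho' : R) : Prop :=
  [/\ (0 < size C)%N, rho' <= rho x / 2,
    forall c, c \in C -> [/\ node c, P k c, B c `<=` B x & rho c = rho'] &
    forall (U : set T) r, 0 < r < rho x -> diam_le r U ->
      (hits U C)%:R * hit_weight rho' r <= (size C)%:R / 2 * ((r / rho x) `^ s / c0)].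

Context (c0_gt0 : 0 < c0) (node_rho : forall x, node x -> 0 < rho x).
Context (children : forall k x, node x -> exists C rho', spread_children k x C rho').
Context (U : nat -> set T) (r : nat -> R).
Context (r_gt0 : forall i, 0 < r i) (U_diam : forall i, diam_le (r i) (U i)).

Definition hit (x : X) (i : nat) : bool := `[< U i `&` B x !=set0 >].

(** Invariant of the construction, stated on finite partial sums to spare a convergence argument. *)
Definition sparse (x : X) : Prop :=
  (forall i, hit x i -> r i < rho x) /\
  (forall n, \sum_(i < n | hit x i) (r i / rho x) `^ s <= c0).

Lemma hit_weight_ge0 rho' u : 0 <= hit_weight rho' u.
Proof. by rewrite /hit_weight; case: ifP => // _; rewrite divr_ge0 ?powR_ge0 // ltW. Qed.

Lemma sparse_child k x : node x -> sparse x ->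
  exists c, [/\ node c, P k c, B c `<=` B x, rho c <= rho x / 2 & sparse c].
Proof.
move=> nx [sp1 sp2]; have [C [rho' [C0 r2 HC star]]] := children k nx.
have hitS c i : c \in C -> hit c i -> hit x i.
  move=> /HC[_ _ sub _] /asboolP[t [Ut Bt]]; apply/asboolP.
  by exists t; split => //; apply: sub.
(* The score of a child: total weight of those among the first n cover sets that meet it. *)
pose sc n c : R := \sum_(i < n | hit x i) (if hit c i then hit_weight rho' (r i) else 0).
have avg n : \sum_(c <- C) sc n c <= (size C)%:R / 2.
  rewrite exchange_big /=.
  apply: le_trans (_ : \sum_(i < n | hit x i) ((size C)%:R / 2 * ((r i / rho x) `^ s / c0)) <= _).
    apply: ler_sum => i hi.
    rewrite -big_mkcond /= big_const_seq iter_addr_0 -[X in X <= _]mulr_natl.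
    by apply: star => //; rewrite r_gt0 sp1.
  rewrite -mulr_sumr ler_piMr ?divr_ge0 // -mulr_suml ler_pdivrMr // mul1r.
  exact: sp2.
have ex n : exists2 c, c \in C & sc n c <= 1 / 2.
  apply: contrapT => H.
  have : \sum_(c <- C) (1 / 2 : R) < \sum_(c <- C) sc n c.
    rewrite [X in _ < X](_ : _ = \sum_(c <- C | c \in C) sc n c); last by rewrite -big_seq.
    rewrite [X in X < _]big_seq.
    apply: ltr_sum => [|c cC]; first by apply/hasP; exists (nth x C 0); rewrite mem_nth.
    by rewrite ltNge; apply/negP => h; apply: H; exists c.
  rewrite ltNge => /negP; apply; apply: le_trans (avg n) _.
  by rewrite big_const_seq count_predT iter_addr_0 -[X in _ <= X]mulr_natl mul1r.
have mono n m c : (n <= m)%N -> sc n c <= sc m c.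
  move=> nm; rewrite /sc.
  rewrite -(big_mkord (hit x) (fun i => if hit c i then hit_weight rho' (r i) else 0)).
  rewrite -(big_mkord (hit x) (fun i => if hit c i then hit_weight rho' (r i) else 0)).
  rewrite [X in _ <= X](big_cat_nat (n := n)) //= lerDl sumr_ge0 // => i _.
  by case: ifP => // _; apply: hit_weight_ge0.
(* So far the child depends on n. Scores increase with n and [C] is finite: if each child failed at
   some index, all would fail at the maximum of these indices. *)
have [c cC hc] : exists2 c, c \in C & forall n, sc n c <= 1 / 2.
  apply: contrapT => H.
  have {}H c : exists n, c \in C -> 1 / 2 < sc n c.
    have [cC|cC] := boolP (c \in C); last by exists 0%N.
    apply: contrapT => Hn; apply: H; exists c => // n; rewrite leNgt; apply/negP => h.
    by apply: Hn; exists n.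
  have [f hf] := choice H.
  have [c cC] := ex (\max_(c <- C) f c); rewrite leNgt => /negP; apply.
  apply: lt_le_trans (hf c cC) _; apply: mono.
  exact: leq_bigmax_seq.
have [nc pc sub rc] := HC c cC.
have term n i : (i < n)%N -> hit c i -> hit_weight rho' (r i) <= 1 / 2.
  move=> ni hi; apply: le_trans (hc n).
  rewrite /sc (bigD1 (Ordinal ni)) /=; last exact: (hitS c).
  rewrite hi lerDl sumr_ge0 // => j _.
  by case: ifP => // _; apply: hit_weight_ge0.
(* A set of size at least rho' has weight 1 > 1 / 2, so none of them meets [c]. *)
have small i : hit c i -> r i < rho'.
  move=> /(term _ _ (ltnSn i)); rewrite /hit_weight ltNge.
  by case: ifP => // _ h; exfalso; lra.
exists c; split => //; first by rewrite rc.
split; rewrite rc // => n.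
have := hc n; rewrite /sc -big_mkcondr /=.
rewrite (eq_bigl (fun i : 'I_n => hit c i)); last first.
  by move=> i; apply/andP/idP => [[]//|h]; split => //; apply: (hitS c).
rewrite (eq_bigr (fun i : 'I_n => (r i / rho') `^ s / c0)); last first.
  by move=> i /small; rewrite ltNge /hit_weight => /negbTE ->.
rewrite -mulr_suml ler_pdivrMr // => h; apply: le_trans h _.
by rewrite ler_piMl ?ltW //; lra.
Qed.

(** Dependent choice along [sparse_child]. A common point lying in [U i] would make [U i] meet every
    ball of the chain, and [r i] would be below radii that tend to 0. *)
Lemma nested_nodes_miss x0 : node x0 -> sparse x0 ->
  exists xs : nat -> X, [/\ forall k, node (xs k), forall k, P k (xs k.+1),
    forall k, B (xs k.+1) `<=` B (xs k), forall k, rho (xs k.+1) <= rho (xs k) / 2 &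
    forall t, (forall k, B (xs k) t) -> forall i, ~ U i t].
Proof.
move=> n0 s0.
pose S := {x : X | node x /\ sparse x}.
have nxt (k : nat) (x : S) : exists y : S,
    [/\ P k (sval y), B (sval y) `<=` B (sval x) & rho (sval y) <= rho (sval x) / 2].
  case: x => x [nx sx] /=; have [c [nc pc sub rc sc]] := sparse_child k nx sx.
  by exists (exist _ c (conj nc sc)).
pose nx k x := sval (cid (nxt k x)).
pose fix ys (k : nat) : S := if k is k'.+1 then nx k' (ys k') else exist _ x0 (conj n0 s0).
have Hys k := svalP (cid (nxt k (ys k))).
have rho_le k : rho (sval (ys k)) <= rho x0 / 2 ^+ k.
  elim: k => [|k IH]; first by rewrite expr0 divr1.
  have [_ _ h] := Hys k; apply: le_trans h _.
  by rewrite exprSr invfM mulrA ler_pM2r // invr_gt0.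
exists (fun k => sval (ys k)); split.
- by move=> k; case: (svalP (ys k)).
- by move=> k; case: (Hys k).
- by move=> k; case: (Hys k).
- by move=> k; case: (Hys k).
move=> t Bt i Ut.
have lt k : r i < rho x0 / 2 ^+ k.
  apply: lt_le_trans (rho_le k); have [_ [h _]] := svalP (ys k); apply: h.
  by apply/asboolP; exists t; split.
have := lt (Num.Def.archi_bound (rho x0 / r i)); rewrite ltNge => /negP; apply.
rewrite ler_pdivrMr ?exprn_gt0 // mulrC -ler_pdivrMr //.
apply: le_trans (ltW (archi_boundP _)) _.
  by rewrite divr_ge0 // ltW // ?r_gt0 ?node_rho.
by rewrite -natrX ler_nat ltnW // ltn_expl.
Qed.

End cantor_scheme.

Section hausdorff_lower_bound.
Context {R : realType} {T : Type} (dist : T -> T -> R) {X : eqType}.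
Context (node : X -> Prop) (rho : X -> R) (B : X -> set T) (P : nat -> X -> Prop).
Context (s c0 : R) (A : set T) (x0 : X).
Context (s_gt0 : 0 < s) (c0_gt0 : 0 < c0) (node_rho : forall x, node x -> 0 < rho x).
Context (children : forall k x, node x ->
  exists C rho', spread_children dist node rho B P s c0 k x C rho').
Context (limit_point : forall xs : nat -> X, (forall k, node (xs k)) ->
  (forall k, P k (xs k.+1)) -> (forall k, B (xs k.+1) `<=` B (xs k)) ->
  (forall k, rho (xs k.+1) <= rho (xs k) / 2) -> exists2 t, A t & forall k, B (xs k) t).

Lemma hausdorff_measure_cantor_neq0 : node x0 -> hausdorff_measure dist s A <> 0%E.
Proof.
move=> n0 H0; have rho0 := node_rho n0.
(* Two budgets of [eta] are spent, on the cover and on its enlargement, and together they must stay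
   below c0 rho^s. The minimum with 1 keeps [eta] below rho^s, so that the enlarged sets remain
   smaller than the root ball. *)
pose eta := Num.min c0 1 / 4 * (rho x0) `^ s.
have m0 : 0 < Num.min c0 1 by rewrite lt_min c0_gt0 ltr01.
have eta0 : 0 < eta by rewrite !mulr_gt0 ?powR_gt0.
have pre0 : (hausdorff_premeasure dist s (rho x0 / 2) A <= 0)%E.
  by rewrite -H0; apply: ereal_sup_ubound; exists (rho x0 / 2) => //=; rewrite divr_gt0.
have [V [cov dV] /= sumV] : exists2 V, delta_cover dist (rho x0 / 2) A V &
    (\sum_(0 <= i <oo) (diameter dist (V i) `^ s) < eta%:E)%E.
  have : (hausdorff_premeasure dist s (rho x0 / 2) A < eta%:E)%E.
    by apply: le_lt_trans pre0 _; rewrite lte_fin.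
  by move=> /ereal_inf_lt[_ [V cV <-] h]; exists V.
have d_ge0 i : (0 <= diameter dist (V i))%E by rewrite le_max lexx.
pose D i := fine (diameter dist (V i)).
have DE i : diameter dist (V i) = (D i)%:E.
  rewrite fineK // ge0_fin_numE //; apply: le_lt_trans (dV i) _; exact: ltry.
have D0 i : 0 <= D i by rewrite -lee_fin -DE.
have Dle i : D i <= rho x0 / 2 by rewrite -lee_fin -DE.
have part n : \sum_(i < n) D i `^ s <= eta.
  rewrite -lee_fin; apply: le_trans (ltW sumV).
  rewrite -sumEFin; apply: le_trans (nneseries_lim_ge n _).
    by rewrite big_mkord; apply: lee_sum => i _; rewrite DE poweR_EFin.
  by move=> i _; rewrite poweR_ge0.
(* Cover sets may have diameter 0, while the scheme asks for sizes [r i] > 0; the [ei i] are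
   positive lower bounds whose s-th powers sum to at most [eta]. *)
pose ei (i : nat) := (eta / 2 ^+ i.+1) `^ s^-1.
have ei0 i : 0 < ei i by rewrite powR_gt0 // divr_gt0 ?exprn_gt0.
have eis i : ei i `^ s = eta / 2 ^+ i.+1.
  by rewrite /ei -powRrM mulVf ?gt_eqF // powRr1 // ltW // divr_gt0 ?exprn_gt0.
pose r i := Num.max (D i) (ei i).
have geo n : \sum_(i < n) ei i `^ s <= eta.
  have -> : \sum_(i < n) ei i `^ s = eta * (1 - 2 ^- n).
    elim: n => [|n IH]; first by rewrite big_ord0 expr0 invr1 subrr mulr0.
    rewrite big_ord_recr /= IH eis exprS invfM; field.
    by rewrite expf_neq0 // pnatr_eq0.
  by rewrite ler_piMr ?ltW // lerBlDr lerDl invr_ge0 exprn_ge0.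
have eilt i : ei i < rho x0.
  have -> : rho x0 = (rho x0 `^ s) `^ s^-1 by rewrite -powRrM mulfV ?gt_eqF // powRr1 // ltW.
  apply: gt0_ltr_powR; rewrite ?invr_gt0 ?nnegrE ?powR_ge0 //.
    by rewrite divr_ge0 ?ltW ?exprn_gt0.
  apply: le_lt_trans (_ : eta < _).
    by rewrite ler_pdivrMr ?exprn_gt0 // ler_peMr ?(ltW eta0) // exprn_ege1 // ler1n.
  rewrite /eta gtr_pMl ?powR_gt0 //.
  have : Num.min c0 1 <= 1 by rewrite ge_min lexx orbT.
  lra.
have r0 i : 0 < r i by rewrite lt_max ei0 orbT.
have diamV i : diam_le dist (r i) (V i).
  move=> u v Vu Vv; rewrite le_max; apply/orP; left.
  rewrite -lee_fin -DE le_max; apply/orP; right.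
  by apply: ereal_sup_ubound; exists (u, v).
have sp : sparse rho B s c0 V r x0.
  split=> [i _|n].
    rewrite gt_max eilt andbT; apply: le_lt_trans (Dle i) _.
    by rewrite gtr_pMr // invf_lt1 // ltr1n.
  apply: le_trans (_ : \sum_(i < n) (r i / rho x0) `^ s <= _).
    rewrite [X in _ <= X](bigID (fun i : 'I_n => hit B V x0 i)) /= lerDl.
    by apply: sumr_ge0 => i _; apply: powR_ge0.
  have rhos : 0 < rho x0 `^ s by rewrite powR_gt0.
  apply: le_trans (_ : (\sum_(i < n) (D i `^ s + ei i `^ s)) / rho x0 `^ s <= _).
    rewrite mulr_suml; apply: ler_sum => i _.
    rewrite (powR_div s (ltW (r0 i)) (ltW rho0)) ler_pM2r ?invr_gt0 // /r.
    case: (leP (D i) (ei i)) => _.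
      by rewrite lerDr powR_ge0.
    by rewrite lerDl powR_ge0.
  rewrite ler_pdivrMr // big_split /=; apply: le_trans (lerD (part n) (geo n)) _.
  have : Num.min c0 1 * rho x0 `^ s <= c0 * rho x0 `^ s.
    by rewrite ler_pM2r // ge_min lexx.
  rewrite /eta; have := mulr_gt0 m0 rhos; lra.
have [xs [h1 h2 h3 h4 h5]] := nested_nodes_miss c0_gt0 node_rho children r0 diamV n0 sp.
have [t At Bt] := limit_point h1 h2 h3 h4.
have [i _ Vt] := cov t At.
exact: (h5 t Bt i).
Qed.

End hausdorff_lower_bound.

(** * Size of a hit *)

Section numeric_spread.
Context {R : realType}.

Lemma powR_gap (Q : nat) (a b eps Z : R) : (0 < Q)%N -> b + eps <= a ->
  Z <= Q%:R `^ eps -> 0 <= Z -> Z * Q%:R `^ b <= Q%:R `^ a.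
Proof.
move=> Q0 h hZ Z0; apply: le_trans (_ : Q%:R `^ eps * Q%:R `^ b <= _).
  by rewrite ler_wpM2r ?powR_ge0.
rewrite -powRD; last by rewrite pnatr_eq0 -lt0n Q0 implybT.
by apply: ler_powR; [rewrite ler1n | lra].
Qed.

(** [k] is the dimension of the family (1 or 2), [P] the number of primes, [n] the number of
    children and [h] the number of those hit. Above 1 / Q the bound on [h] comes from the even
    spread of the fractions of each prime, between Q^(- tau) and 1 / Q from their mutual spacing of
    order Q^(-2), and below the child radius only O(1) children are hit. *)
Lemma hit_weight_le (k Q P n h : nat) (s tau eps c D rho r : R) :
  (0 < k)%N -> (0 < Q)%N -> 0 < s -> s <= k%:R -> 2 <= tau -> 0 < eps ->
  tau * s + 2 * eps <= k%:R + 1 -> (s < 1 -> 2 * eps <= 1 - s) ->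
  0 < c -> 0 < D -> 0 < rho <= 1 ->
  2 / rho ^+ k <= Q%:R `^ eps -> 2 * D / (c * rho ^+ k) <= Q%:R `^ eps ->
  Q%:R `^ (1 - eps) <= P%:R ->
  c * rho ^+ k * (P%:R * Q%:R ^+ k) <= n%:R ->
  0 < r < rho ->
  (Q%:R^-1 <= r -> h%:R <= D * (P%:R * (r * Q%:R) ^+ k)) ->
  (Q%:R `^ (- tau) <= r < Q%:R^-1 -> h%:R <= D * (1 + r * Q%:R ^+ 2)) ->
  (r < Q%:R `^ (- tau) -> h%:R <= D) ->
  h%:R * hit_weight s (c / (2 * D)) (Q%:R `^ (- tau)) r <=
    n%:R / 2 * ((r / rho) `^ s / (c / (2 * D))).
Proof.
move=> k0 Q0 s0 sk tau2 eps0 gap gap1 c0 D0 /andP[rho0 rho1] big1 big2 hP hn /andP[r0 rr] h1 h2 h3.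
have r0' := ltW r0; have rho0' := ltW rho0.
have D0' := ltW D0; have c0' := ltW c0; have s0' := ltW s0.
have QR : 0 < Q%:R :> R by rewrite ltr0n.
have Q1 : 1 <= Q%:R :> R by rewrite ler1n.
have rk0 : 0 < rho ^+ k by rewrite exprn_gt0.
have rk0' := ltW rk0.
have tN : Q%:R `^ (- tau) <= Q%:R^-1.
  by rewrite -powR_inv1 //; apply: ler_powR => //; lra.
have rs0 : 0 < r `^ s by rewrite powR_gt0.
have rrho : r `^ s <= (r / rho) `^ s.
  apply: ge0_ler_powR; rewrite ?nnegrE ?divr_ge0 //.
  by rewrite ler_pdivlMr // ler_piMr // ltW.
have PQ : Q%:R `^ (k%:R + 1 - eps) <= P%:R * Q%:R ^+ k.
  have -> : k%:R + 1 - eps = (1 - eps) + k%:R by ring.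
  rewrite powRD; last by rewrite pnatr_eq0 -lt0n Q0 implybT.
  by rewrite powR_mulrn // ler_pM2r // exprn_gt0.
(* The choice c0 = c / (2 D) makes the right side n (D / c) Y: the density [c] of the children
   cancels, and the constant [D] of the hit bounds remains. *)
have lowRHS Y : 0 <= Y -> D * (rho ^+ k * (P%:R * Q%:R ^+ k)) * Y <= n%:R / 2 * (Y / (c / (2 * D))).
  move=> Y0; have -> : n%:R / 2 * (Y / (c / (2 * D))) = n%:R * (D / c) * Y.
    by field; rewrite !gt_eqF.
  rewrite ler_wpM2r // mulrA -ler_pdivrMr ?divr_gt0 //.
  by apply: le_trans hn; rewrite le_eqVlt; apply/orP; left; apply/eqP; field; rewrite !gt_eqF.
have [ge1|lt1] := leP Q%:R^-1 r.
  rewrite /hit_weight (le_trans tN ge1) mulr1.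
  apply: le_trans (h1 ge1) _; apply: le_trans (lowRHS _ (powR_ge0 _ _)).
  (* This is (r / rho)^k <= (r / rho)^s, where s <= k enters. *)
  have hh : r ^+ k <= rho ^+ k * (r / rho) `^ s.
    have -> : r ^+ k = rho ^+ k * (r / rho) ^+ k.
      by rewrite exprMn mulrCA exprVn divff ?mulr1 // gt_eqF.
    rewrite ler_pM2l // -powR_mulrn ?divr_ge0 //; apply: ger_powR => //.
    by rewrite divr_gt0 //= ler_pdivrMr // mul1r ltW.
  have H := ler_wpM2l (mulr_ge0 D0' (mulr_ge0 (ler0n R P) (exprn_ge0 k (ltW QR)))) hh.
  rewrite exprMn; set u := r ^+ k in H *; set v := Q%:R ^+ k in H *; set w := rho ^+ k in H *.
  set y := (r / rho) `^ s in H *; lra.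
have [ge2|lt2] := leP (Q%:R `^ (- tau)) r.
  rewrite /hit_weight ge2 mulr1.
  apply: le_trans (h2 _) _; first by rewrite ge2.
  apply: le_trans (lowRHS _ (powR_ge0 _ _)).
  rewrite -[X in _ <= X]mulrA ler_pM2l //.
  apply: le_trans (_ : rho ^+ k * Q%:R `^ (k%:R + 1 - eps) * r `^ s <= _); last first.
    rewrite -!mulrA ler_pM2l // mulrA; apply: ler_pM => //; rewrite ?powR_ge0 //.
  (* Worst at the smallest radius r = Q^(- tau), where tau s + 2 eps <= k + 1 is what is needed. *)
  have A1 : 1 <= rho ^+ k / 2 * Q%:R `^ (k%:R + 1 - eps) * r `^ s.
    have g1 : 2 / rho ^+ k * Q%:R `^ (tau * s) <= Q%:R `^ (k%:R + 1 - eps).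
      apply: (@powR_gap _ _ _ eps) => //; first by lra.
      by rewrite divr_ge0 // ltW.
    have g2 : Q%:R `^ (- (tau * s)) <= r `^ s.
      rewrite -mulNr powRrM; apply: ge0_ler_powR; rewrite ?nnegrE ?powR_ge0 //.
    have e : rho ^+ k / 2 * (2 / rho ^+ k * Q%:R `^ (tau * s)) * Q%:R `^ (- (tau * s)) = 1.
      by rewrite powRN; field; rewrite !gt_eqF // powR_gt0.
    rewrite -[X in X <= _]e; apply: ler_pM => //; rewrite ?powR_ge0 //.
      by rewrite !mulr_ge0 ?powR_ge0 ?invr_ge0 //.
    by rewrite ler_pM2l // divr_gt0.
  have A2 : r * Q%:R ^+ 2 <= rho ^+ k / 2 * Q%:R `^ (k%:R + 1 - eps) * r `^ s.
    have rE : r = r `^ (1 - s) * r `^ s.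
      by rewrite -powRD ?subrK ?powRr1 // gt_eqF // implybT.
    have g1 : 2 / rho ^+ k * Q%:R `^ (k%:R + 1 - 2 * eps) <= Q%:R `^ (k%:R + 1 - eps).
      apply: (@powR_gap _ _ _ eps) => //; first by lra.
      by rewrite divr_ge0 // ltW.
    (* For s < 1 the left side is largest at r = 1 / Q, and [gap1] settles it. For s >= 1 the
       exponent is not positive, the worst case is r = Q^(- tau), and tau >= 2 reduces it to
       [gap]. *)
    have g2 : r `^ (1 - s) <= Q%:R `^ (k%:R - 1 - 2 * eps).
      have [sl|sg] := ltP s 1.
        have sl' := ltW sl; have lt1' := ltW lt1.
        apply: le_trans (_ : (Q%:R^-1) `^ (1 - s) <= _).
          by apply: ge0_ler_powR; rewrite ?nnegrE ?invr_ge0 ?subr_ge0 //.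
        rewrite -powR_inv1 // -powRrM; apply: ler_powR => //.
        have : 1 <= k%:R :> R by rewrite ler1n.
        have := gap1 sl; lra.
      apply: le_trans (_ : (Q%:R `^ (- tau)) `^ (1 - s) <= _).
        rewrite -[1 - s]opprB (powRN r) (powRN (Q%:R `^ (- tau))) lef_pV2 ?posrE ?powR_gt0 //.
        apply: ge0_ler_powR; rewrite ?nnegrE ?subr_ge0 ?powR_ge0 //.
      rewrite -powRrM; apply: ler_powR => //; nra.
    have e2 : Q%:R `^ (k%:R - 1 - 2 * eps) * Q%:R ^+ 2 = Q%:R `^ (k%:R + 1 - 2 * eps).
      rewrite -powR_mulrn // -powRD; first by congr (_ `^ _); ring.
      by rewrite (gt_eqF QR) implybT.
    rewrite {1}rE mulrAC ler_pM2r //.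
    apply: le_trans (_ : Q%:R `^ (k%:R + 1 - 2 * eps) <= _).
      by rewrite -e2 ler_pM2r // exprn_gt0.
    move: g1; rewrite mulrC -ler_pdivlMr ?divr_gt0 // => /le_trans; apply.
    by rewrite le_eqVlt; apply/orP; left; apply/eqP; field; rewrite !gt_eqF.
  have -> : rho ^+ k * Q%:R `^ (k%:R + 1 - eps) * r `^ s =
    rho ^+ k / 2 * Q%:R `^ (k%:R + 1 - eps) * r `^ s +
    rho ^+ k / 2 * Q%:R `^ (k%:R + 1 - eps) * r `^ s by field.
  exact: lerD.
(* Below the child radius r^s cancels from both sides, and Q^(tau s) is compared with the number of
   children. *)
rewrite /hit_weight [X in if X then _ else _]leNgt lt2 /=.
have cD : 0 < c / (2 * D) by rewrite divr_gt0 // mulr_gt0.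
rewrite mulrA [X in _ <= X]mulrA ler_pM2r ?invr_gt0 //.
apply: le_trans (_ : D * (r / Q%:R `^ (- tau)) `^ s <= _).
  by rewrite ler_wpM2r ?powR_ge0 // h3.
apply: le_trans (_ : n%:R / 2 * r `^ s <= _); last by rewrite ler_wpM2l // divr_ge0.
have -> : (r / Q%:R `^ (- tau)) `^ s = r `^ s * Q%:R `^ (tau * s).
  by rewrite powRM ?invr_ge0 ?powR_ge0 // powRN invrK -powRrM.
rewrite [r `^ s * _]mulrC mulrA ler_pM2r //.
have g1 : 2 * D / (c * rho ^+ k) * Q%:R `^ (tau * s) <= Q%:R `^ (k%:R + 1 - eps).
  apply: (@powR_gap _ _ _ eps) => //; first by lra.
  by rewrite divr_ge0 ?mulr_ge0 // ltW.
have g2 : c * rho ^+ k * (2 * D / (c * rho ^+ k) * Q%:R `^ (tau * s)) <= n%:R.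
  apply: le_trans hn; rewrite ler_pM2l ?mulr_gt0 //; exact: le_trans g1 PQ.
rewrite ler_pdivlMr //; apply: le_trans g2.
by rewrite le_eqVlt; apply/orP; left; apply/eqP; field; rewrite !gt_eqF.
Qed.

End numeric_spread.

(** * Counting fractions *)

Section counting.
Context {R : realType}.

(** Pigeonhole: for a fixed i0, the integer parts of (f i - f i0 + L) / delta are distinct and lie
    between 0 and 2 L / delta. *)
Lemma separated_count (I : eqType) (l : seq I) (f : I -> R) (delta L : R) :
  uniq l -> 0 < delta -> 0 <= L ->
  {in l &, forall i j, i != j -> delta <= `|f i - f j|} ->
  {in l &, forall i j, `|f i - f j| <= L} ->
  (size l)%:R <= 1 + 2 * L / delta.
Proof.
move=> ul d0 L0 sep near.
case: l ul sep near => [|i0 l'] ul sep near; first by rewrite addr_ge0 // divr_ge0 ?mulr_ge0 // ltW.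
set l := i0 :: l' in ul sep near *.
have i0l : i0 \in l by rewrite mem_head.
pose v i := (f i - f i0 + L) / delta.
have v0 i : i \in l -> 0 <= v i.
  move=> il; rewrite divr_ge0 ?(ltW d0) //; have := near _ _ il i0l.
  rewrite ler_norml => /andP[]; lra.
have v1 i : i \in l -> v i <= 2 * L / delta.
  move=> il; rewrite ler_pM2r ?invr_gt0 //; have := near _ _ il i0l.
  rewrite ler_norml => /andP[]; lra.
have Z0 : 0 <= 2 * L / delta by rewrite divr_ge0 ?mulr_ge0 // ltW.
have inj : {in l &, injective (fun i => Num.Def.trunc (v i))}.
  move=> i j il jl e; apply/eqP; apply: contraT => ij.
  have := sep _ _ il jl ij; have /andP[a1 a2] := truncn_itv (v0 _ il).
  have /andP[b1 b2] := truncn_itv (v0 _ jl); rewrite e in a1 a2.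
  have : `|v i - v j| < 1.
    by rewrite ltr_norml; apply/andP; split; move: a1 a2 b1 b2; rewrite -natr1; lra.
  have -> : v i - v j = (f i - f j) / delta by rewrite /v; field; rewrite gt_eqF.
  rewrite normrM normfV [`|delta|]gtr0_norm // ltr_pdivrMr // mul1r ltNge => /negP h /h [].
have : (size l <= size (iota 0 (Num.Def.trunc (2 * L / delta)).+1))%N.
  rewrite -(size_map (fun i => Num.Def.trunc (v i))); apply: uniq_leq_size.
    by rewrite map_inj_in_uniq.
  move=> _ /mapP[i il ->]; rewrite mem_iota add0n ltnS.
  exact: le_truncn (v1 _ il).
rewrite size_iota -(ler_nat R) => h; apply: le_trans h _.
by rewrite -natr1 addrC lerD2l; have /andP[] := truncn_itv Z0.
Qed.

Definition frac2 (i : nat * nat) : R := i.2%:R / i.1.*2%:R.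

(** The last two conditions put a / (2p) in lowest terms, so that distinct pairs give distinct
    fractions. *)
Definition admissible (Q : nat) (i : nat * nat) : bool :=
  [&& i.1 \in primes_in Q, odd i.2 & ~~ (i.1 %| i.2)%N].

(** The cross-multiplied numerator is a nonzero integer and the denominators share a factor 2: the
    difference is at least 1 / (2 p p') with p, p' <= 2 Q. *)
Lemma admissible_sep Q i j : (0 < Q)%N -> admissible Q i -> admissible Q j -> i != j ->
  (8 * Q%:R ^+ 2)^-1 <= `|frac2 i - frac2 j|.
Proof.
case: i j => [p a] [p' a'] Q0 /and3P[/= hp oa pa] /and3P[/= hp' oa' pa'] ij.
move: hp hp'; rewrite !mem_primes_in => /and3P[pp p1 p2] /and3P[pp' p1' p2'].
have neq : (a * p' != a' * p)%N.
  apply/eqP => e; case: (eqVneq p p') => [pe|pe].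
    subst p'; move/eqP: e; rewrite eqn_pmul2r ?prime_gt0 // => /eqP ae.
    by move: ij; rewrite ae eqxx.
  have : (p %| a * p')%N by rewrite e dvdn_mull.
  rewrite Euclid_dvdM // (negbTE pa) /= dvdn_prime2 // => /eqP h.
  by rewrite h eqxx in pe.
have P0 : 0 < p%:R :> R by rewrite ltr0n prime_gt0.
have P0' : 0 < p'%:R :> R by rewrite ltr0n prime_gt0.
have -> : frac2 (p, a) - frac2 (p', a') = ((a * p')%:R - (a' * p)%:R) / (2 * (p%:R * p'%:R)).
  by rewrite /frac2 /= !natrM -!muln2 !natrM; field; rewrite !gt_eqF.
rewrite normrM [`|(_ * _)^-1|]gtr0_norm ?invr_gt0 ?mulr_gt0 //.
have num : 1 <= `|(a * p')%:R - (a' * p)%:R| :> R.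
  case: (ltngtP (a * p') (a' * p)) neq => // h _.
    by rewrite distrC -natrB ?(ltnW h) // normr_nat ler1n subn_gt0.
  by rewrite -natrB ?(ltnW h) // normr_nat ler1n subn_gt0.
have den : 2 * (p%:R * p'%:R) <= 8 * Q%:R ^+ 2 :> R.
  have -> : 8 * Q%:R ^+ 2 = 2 * (Q.*2%:R * Q.*2%:R) :> R by rewrite -muln2 natrM; ring.
  by rewrite ler_pM2l // ler_pM // ler_nat.
rewrite ler_pdivlMr ?mulr_gt0 // ; apply: le_trans num.
by rewrite mulrC ler_pdivrMr ?mulr_gt0 ?exprn_gt0 ?ltr0n // mul1r.
Qed.

Lemma admissible_count Q (l : seq (nat * nat)) (L : R) : (0 < Q)%N -> uniq l -> 0 <= L ->
  {in l, forall i, admissible Q i} -> {in l &, forall i j, `|frac2 i - frac2 j| <= L} ->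
  (size l)%:R <= 1 + 16 * L * Q%:R ^+ 2.
Proof.
move=> Q0 ul L0 adm near.
have Q2 : 0 < 8 * Q%:R ^+ 2 :> R by rewrite mulr_gt0 // exprn_gt0 // ltr0n.
have -> : 16 * L * Q%:R ^+ 2 = 2 * L / (8 * Q%:R ^+ 2)^-1 by rewrite invrK; ring.
apply: separated_count near => //; first by rewrite invr_gt0.
by move=> i j il jl; apply: admissible_sep; [| exact: adm | exact: adm].
Qed.

Lemma multiples_count (l : seq nat) (n Q : nat) (L : R) : (0 < n <= 4 * Q)%N -> uniq l -> 0 <= L ->
  {in l &, forall a b, `|a%:R / n%:R - b%:R / n%:R| <= L} ->
  (size l)%:R <= 1 + 8 * L * Q%:R.
Proof.
move=> /andP[n0 nQ] ul L0 near.
have N0 : 0 < n%:R :> R by rewrite ltr0n.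
apply: le_trans (_ : 1 + 2 * L / n%:R^-1 <= _).
  apply: separated_count near => //; first by rewrite invr_gt0.
  move=> a b _ _ ab; rewrite -mulrBl normrM normfV normr_nat ler_pMl ?invr_gt0 //.
  case: (ltngtP a b) ab => // h _.
    by rewrite distrC -natrB ?(ltnW h) // normr_nat ler1n subn_gt0.
  by rewrite -natrB ?(ltnW h) // normr_nat ler1n subn_gt0.
rewrite invrK lerD2l.
have -> : 8 * L * Q%:R = 2 * L * (4 * Q)%:R by rewrite natrM; ring.
by rewrite ler_wpM2l ?mulr_ge0 // ler_nat.
Qed.

Lemma count_pairs (S V : Type) (s : seq S) (t : S -> seq V) (p : pred (S * V)) :
  count p [seq (x, y) | x <- s, y <- t x] = (\sum_(x <- s) count (fun y => p (x, y)) (t x))%N.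
Proof.
elim: s => [|x s IH]; first by rewrite big_nil.
by rewrite big_cons /= count_cat IH count_map.
Qed.

Definition pairs_in (Q : nat) : seq (nat * nat) :=
  [seq (p, a) | p <- primes_in Q, a <- iota 0 p.*2].

Lemma pairs_in_uniq Q : uniq (pairs_in Q).
Proof.
apply: allpairs_uniq_dep => [||[p a] [p' a'] _ _ /= [-> ->]] //.
  by rewrite filter_uniq // iota_uniq.
by move=> p _; apply: iota_uniq.
Qed.

(** The first bound uses the spacing of all fractions together; the second treats the primes one by
    one, with spacing 1 / (2p), and keeps the actual number of primes as a factor, as does the lower
    bound for the number of children. *)
Lemma pairs_in_count Q (p : pred (nat * nat)) (L : R) : (0 < Q)%N -> 0 <= L ->
  {in p, forall i, admissible Q i} -> {in p &, forall i j, `|frac2 i - frac2 j| <= L} ->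
  (count p (pairs_in Q))%:R <= 1 + 16 * L * Q%:R ^+ 2 /\
  (count p (pairs_in Q))%:R <= (size (primes_in Q))%:R * (1 + 8 * L * Q%:R).
Proof.
move=> Q0 L0 adm near; split.
  rewrite -size_filter; apply: (@admissible_count Q) => //.
  - by rewrite filter_uniq // pairs_in_uniq.
  - by move=> i; rewrite mem_filter => /andP[/adm].
  - by move=> i j; rewrite !mem_filter => /andP[hi _] /andP[hj _]; apply: near.
rewrite count_pairs natr_sum.
apply: le_trans (_ : \sum_(q <- primes_in Q) (1 + 8 * L * Q%:R) <= _); last first.
  by rewrite big_const_seq count_predT iter_addr_0 -[X in X <= _]mulr_natl.
rewrite big_seq [X in _ <= X]big_seq; apply: ler_sum => q.
rewrite mem_primes_in => /and3P[qp q1 q2]; rewrite -size_filter.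
apply: (@multiples_count _ q.*2) => //.
- by rewrite double_gt0 prime_gt0 //=; lia.
- by rewrite filter_uniq // iota_uniq.
- by move=> a b; rewrite !mem_filter => /andP[ha _] /andP[hb _]; apply: (near (q, a) (q, b)).
Qed.

(** One block of j serves both b / p with b = j and a / (2p) with a = 2 j + 1 odd, which is (j + 1 /
    2) / p. The block starts at the left end and fills about half of the window; the rest absorbs
    rounding and the half step. *)
Lemma interval_block (x w : R) (p : nat) : (0 < p)%N -> 0 <= x - w -> 1 <= p%:R * w ->
  exists j0 m : nat, p%:R * w - 1 <= m%:R /\
    forall j, (j0 <= j < j0 + m)%N -> x - w <= j%:R / p%:R /\ (j%:R + 2^-1) / p%:R <= x + w.
Proof.
move=> p0 x0 pw.
have P0 : 0 < p%:R :> R by rewrite ltr0n.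
have y0 : 0 <= p%:R * (x - w) by rewrite mulr_ge0 // ltW.
have /andP[a1 a2] := truncn_itv y0.
have /andP[b1 b2] := truncn_itv (le_trans ler01 pw).
set u := Num.Def.trunc (p%:R * (x - w)) in a1 a2.
set m := Num.Def.trunc (p%:R * w) in b1 b2.
exists u.+1, m; split; first by move: b2; rewrite -natr1; lra.
move=> j /andP[j1 j2]; split.
  rewrite ler_pdivlMr // mulrC; apply: le_trans (ltW a2) _; by rewrite ler_nat.
rewrite ler_pdivrMr //.
have : j%:R <= u%:R + m%:R :> R by rewrite -natrD ler_nat; lia.
nra.
Qed.

Lemma count_odd_near (x w : R) (p : nat) : (0 < p)%N -> 0 <= x - w -> x + w < 1 ->
  1 <= p%:R * w ->
  p%:R * w - 1 <= (count (fun a => odd a && (`|frac2 (p, a) - x| <= w)) (iota 0 p.*2))%:R.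
Proof.
move=> p0 x0 x1 pw; have [j0 [m [hm H]]] := interval_block p0 x0 pw.
apply: le_trans hm _; rewrite ler_nat -size_filter -(size_iota j0 m).
have P0 : 0 < p%:R :> R by rewrite ltr0n.
rewrite -(size_map (fun j => j.*2.+1)); apply: uniq_leq_size.
  rewrite map_inj_uniq ?iota_uniq // => a b; lia.
move=> y /mapP[j]; rewrite mem_iota => /H[h1 h2] ->.
rewrite mem_filter mem_iota /= odd_double /= add0n.
have fe : frac2 (p, j.*2.+1) = (j%:R + 2^-1) / p%:R.
  by rewrite /frac2 /= -natr1 -!muln2 !natrM; field; rewrite gt_eqF.
rewrite fe ler_norml; apply/andP; split.
  apply/andP; split; last by lra.
  have : j%:R / p%:R <= (j%:R + 2^-1) / p%:R :> R by rewrite ler_pM2r ?invr_gt0 // lerDl.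
  lra.
have : (j%:R + 2^-1) / p%:R < 1 :> R by apply: le_lt_trans h2 x1.
rewrite ltr_pdivrMr // mul1r => lt; rewrite -(ltr_nat R) -natr1 -!muln2 !natrM; lra.
Qed.

Lemma count_near (x w : R) (p : nat) : (0 < p)%N -> 0 <= x - w -> x + w < 1 ->
  1 <= p%:R * w ->
  p%:R * w - 1 <= (count (fun b => `|b%:R / p%:R - x| <= w) (iota 0 p))%:R.
Proof.
move=> p0 x0 x1 pw; have [j0 [m [hm H]]] := interval_block p0 x0 pw.
apply: le_trans hm _; rewrite ler_nat -size_filter -(size_iota j0 m).
have P0 : 0 < p%:R :> R by rewrite ltr0n.
apply: uniq_leq_size; first exact: iota_uniq.
move=> j; rewrite mem_iota => /H[h1 h2].
have le : j%:R / p%:R <= (j%:R + 2^-1) / p%:R :> R by rewrite ler_pM2r ?invr_gt0 // lerDl.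
rewrite mem_filter mem_iota /= add0n ler_norml; apply/andP; split.
  by apply/andP; split; lra.
have : j%:R / p%:R < 1 :> R by lra.
by rewrite ltr_pdivrMr // mul1r ltr_nat.
Qed.

Lemma count_avoid (V : Type) (s : seq V) (p b : pred V) :
  (count p s <= count (fun x => p x && ~~ b x) s + count b s)%N.
Proof.
rewrite -count_predUI; apply: leq_trans (leq_addr _ _).
by apply: sub_count => x /= ->; case: (b x).
Qed.

Lemma count_dvd_odd p : (0 < p)%N ->
  (count (fun a => odd a && (p %| a)) (iota 0 p.*2) <= 1)%N.
Proof.
move=> p0; rewrite -size_filter -[1%N]/(size [:: p]); apply: uniq_leq_size.
  by rewrite filter_uniq // iota_uniq.
move=> a; rewrite mem_filter mem_iota inE => /andP[/andP[oa /dvdnP[k ek]]]; subst a.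
rewrite add0n -mul2n ltn_pmul2r // => k2.
by case: k oa k2 => [|[|k]] //; rewrite mul1n.
Qed.

End counting.

(** * Choice of the scales *)

Section scales.
Context {R : realType}.

Lemma limn_einf_eq0 (u : nat -> R) : (forall n, 0 <= u n) ->
  (forall k, exists2 n, (k <= n)%N & u n <= k.+1%:R^-1) ->
  limn_einf (fun n => (u n)%:E) = 0%E.
Proof.
move=> u0 H; rewrite limn_einf_lim.
have -> : einfs (fun n => (u n)%:E) = (fun=> 0%E).
  apply/funext => m; apply/eqP; rewrite eq_le; apply/andP; split.
    apply/lee_addgt0Pr => eps eps0; rewrite add0e.
    have [n kn un] := H (maxn m (Num.Def.archi_bound eps^-1)).
    apply: le_trans (_ : (u n)%:E <= _)%E.
      by apply: ereal_inf_lbound; exists n => //=; apply: leq_trans kn; rewrite leq_maxl.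
    rewrite lee_fin; apply: le_trans un _.
    rewrite -[X in _ <= X]invrK lef_pV2 ?posrE ?invr_gt0 ?ltr0n //.
    apply: le_trans (ltW (archi_boundP _)) _; first by rewrite invr_ge0 ltW.
    by rewrite ler_nat; apply: leqW; apply: leq_maxr.
  by apply: le_ereal_inf_tmp => _ [n _ <-]; rewrite lee_fin.
exact: lim_cst.
Qed.

Lemma nested_intervals (lo hi : nat -> R) :
  (forall k, lo k <= lo k.+1) -> (forall k, hi k.+1 <= hi k) -> (forall k, lo k <= hi k) ->
  exists t, forall k, lo k <= t <= hi k.
Proof.
move=> hlo hhi lh.
have mlo m n : (m <= n)%N -> lo m <= lo n.
  by move=> /subnK <-; elim: (n - m)%N => // i IH; apply: le_trans IH (hlo _).
have mhi m n : (m <= n)%N -> hi n <= hi m.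
  by move=> /subnK <-; elim: (n - m)%N => // i IH; apply: le_trans (hhi _) IH.
have ub k : ubound (range lo) (hi k).
  move=> _ [n _ <-]; apply: le_trans (mlo n (maxn n k) (leq_maxl _ _)) _.
  by apply: le_trans (lh _) (mhi _ _ (leq_maxr _ _)).
exists (sup (range lo)) => k; apply/andP; split.
  by apply: ub_le_sup; [exists (hi 0%N); apply: ub | exists k].
by apply: ge_sup; [exists (lo 0%N), 0%N | apply: ub].
Qed.

Lemma good_scale (eps beta tau Z rho : R) (N : nat) : 0 < eps -> 0 < beta -> 0 < tau ->
  0 < rho ->
  exists Q : nat, [/\ (N <= Q)%N, (2 <= Q)%N, Z <= Q%:R `^ eps, Z <= Q%:R `^ beta &
    [/\ Z <= Q%:R, Q%:R `^ (- tau) <= rho / 2 &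
      Q%:R `^ (1 - eps) <= (size (primes_in Q))%:R]].
Proof.
move=> e0 b0 t0 r0.
have [N1 h1] := powR_nat_unbounded Z e0.
have [N2 h2] := powR_nat_unbounded Z b0.
have [N3 h3] := powR_nat_unbounded (2 / rho) t0.
pose N4 := Num.Def.archi_bound `|Z|.
have [Q [hQ Q0 pQ]] := many_primes_in (maxn (maxn N 2) (maxn (maxn N1 N2) (maxn N3 N4))) e0.
move: hQ; rewrite !geq_max => /andP[/andP[a1 a2] /andP[/andP[a3 a4] /andP[a5 a6]]].
exists Q; split => //; [exact: h1 | exact: h2 | split => //].
  apply: le_trans (ler_norm Z) _; apply: le_trans (ltW (archi_boundP _)) _ => //.
  by rewrite ler_nat.
rewrite powRN -[rho / 2]invrK lef_pV2 ?posrE ?invr_gt0 ?divr_gt0 ?powR_gt0 ?ltr0n //.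
by rewrite invfM invrK mulrC h3.
Qed.

(** Here [d] is the degree minus one, so d + 3 / 2 is the degree plus 1 / 2. From 2 p <= 4 Q come d
    + 1 factors 4; the last one bounds sqrt 4. *)
Lemma near_bound_small (d Q p k : nat) (K tau : R) : (0 < Q)%N -> (p <= Q.*2)%N -> 0 < K ->
  16 * d.+1%:R * 4 ^+ d.+2 * Num.sqrt K * k.+1%:R <= Q%:R `^ (tau - (d%:R + 3 / 2)) ->
  16 * (Q%:R `^ (- tau) * (d.+1%:R * p.*2%:R ^+ d)) * (p.*2%:R * Num.sqrt (K * p.*2%:R))
    <= k.+1%:R^-1.
Proof.
move=> Q0 pQ K0 big.
have QR : 0 < Q%:R :> R by rewrite ltr0n.
have q4 : p.*2%:R <= 4 * Q%:R :> R by rewrite -natrM ler_nat; lia.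
have s1 : Num.sqrt (K * p.*2%:R) <= Num.sqrt K * 4 * Q%:R `^ 2^-1.
  rewrite sqrtrM ?(ltW K0) // -mulrA ler_wpM2l ?sqrtr_ge0 //.
  apply: le_trans (_ : Num.sqrt (4 * Q%:R) <= _); first by rewrite ler_wsqrtr.
  rewrite powR12_sqrt // sqrtrM // ler_wpM2r ?sqrtr_ge0 //.
  have -> : 4 = 2 ^+ 2 :> R by ring.
  by rewrite sqrtr_sqr ger0_norm //; lra.
apply: le_trans (_ : 16 * (Q%:R `^ (- tau) * (d.+1%:R * (4 * Q%:R) ^+ d)) *
    ((4 * Q%:R) * (Num.sqrt K * 4 * Q%:R `^ 2^-1)) <= _).
  apply: ler_pM.
  - by rewrite !mulr_ge0 ?powR_ge0 ?exprn_ge0.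
  - by rewrite mulr_ge0 ?sqrtr_ge0.
  - by rewrite ler_pM2l // ler_wpM2l ?powR_ge0 // ler_wpM2l // lerXn2r ?nnegrE ?mulr_ge0.
  - by apply: ler_pM; rewrite ?sqrtr_ge0.
have -> : 16 * (Q%:R `^ (- tau) * (d.+1%:R * (4 * Q%:R) ^+ d)) *
    ((4 * Q%:R) * (Num.sqrt K * 4 * Q%:R `^ 2^-1)) =
  (16 * d.+1%:R * 4 ^+ d.+2 * Num.sqrt K) * (Q%:R `^ (- tau) * (Q%:R ^+ d.+1 * Q%:R `^ 2^-1)).
  by rewrite exprMn !exprS; ring.
have -> : Q%:R `^ (- tau) * (Q%:R ^+ d.+1 * Q%:R `^ 2^-1) =
    (Q%:R `^ (tau - (d%:R + 3 / 2)))^-1 :> R.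
  rewrite -powR_mulrn // -powRD ?(gt_eqF QR) ?implybT // -powRD ?(gt_eqF QR) ?implybT //.
  by rewrite -powRN; congr (_ `^ _); rewrite -natr1; field.
by rewrite ler_pdivrMr ?powR_gt0 // [X in _ <= X]mulrC ler_pdivlMr ?ltr0n.
Qed.

(** [r + 2 * rho'] bounds the distance between the centres of two child balls met by a set of
    diameter r. The constants are 25 = 1 + 8 + 16 and 49 = 1 + 48. *)
Lemma pair_hit_bounds (Q : nat) (P N rho' r : R) : (0 < Q)%N -> 0 <= P -> 0 < rho' -> 0 < r ->
  rho' * Q%:R ^+ 2 <= 1 ->
  N <= 1 + 16 * (r + 2 * rho') * Q%:R ^+ 2 -> N <= P * (1 + 8 * (r + 2 * rho') * Q%:R) ->
  [/\ Q%:R^-1 <= r -> N <= 25 * (P * (r * Q%:R)),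
      rho' <= r -> N <= 49 * (1 + r * Q%:R ^+ 2) & r < rho' -> N <= 49].
Proof.
move=> Q0 P0 rho0 r0 rQ n1 n2.
have QR : 1 <= Q%:R :> R by rewrite ler1n.
have Q2 : 0 <= Q%:R ^+ 2 :> R by rewrite exprn_ge0.
have rhoQ : rho' * Q%:R <= 1.
  by apply: le_trans rQ; rewrite ler_pM2l // expr2 ler_peMl // ltW // (lt_le_trans ltr01).
have QQ : 0 < Q%:R :> R by rewrite ltr0n.
split=> h.
- have rq : 1 <= r * Q%:R by rewrite -ler_pdivrMr // mul1r.
  apply: le_trans n2 _.
  have : 1 + 8 * (r + 2 * rho') * Q%:R <= 25 * (r * Q%:R) by lra.
  by move=> /(ler_wpM2l P0) hh; apply: le_trans hh _; lra.
- have := ler_wpM2r Q2 h; have := mulr_ge0 (ltW r0) Q2; lra.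
- have := ler_wpM2r Q2 (ltW h); lra.
Qed.

Lemma fiber_hit_bounds (Q : nat) (N rho' r : R) : (0 < Q)%N -> 0 < rho' -> 0 < r ->
  rho' * Q%:R ^+ 2 <= 1 -> N <= 1 + 8 * (r + 2 * rho') * Q%:R ->
  (Q%:R^-1 <= r -> N <= 25 * (r * Q%:R)) /\ (r < Q%:R^-1 -> N <= 25).
Proof.
move=> Q0 rho0 r0 rQ n2.
have QR : 1 <= Q%:R :> R by rewrite ler1n.
have rhoQ : rho' * Q%:R <= 1.
  by apply: le_trans rQ; rewrite ler_pM2l // expr2 ler_peMl // ltW // (lt_le_trans ltr01).
have QQ : 0 < Q%:R :> R by rewrite ltr0n.
split=> h.
  have rq : 1 <= r * Q%:R by rewrite -ler_pdivrMr // mul1r.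
  lra.
have rq : r * Q%:R < 1 by rewrite -ltr_pdivlMr // mul1r.
lra.
Qed.

(** [tau] is the midpoint of tau0 and (k + 1) / s, so that tau s < k + 1, and [eps] is at most half
    of the gap left. The bound 5 / 2 on tau0 gives s <= k, even for k = 1. *)
Lemma exponents_exist (k : nat) (tau0 s : R) : (0 < k)%N -> 5 / 2 <= tau0 -> 0 < s ->
  s < (k%:R + 1) / tau0 ->
  exists tau eps : R, [/\ tau0 < tau, 0 < eps, tau * s + 2 * eps <= k%:R + 1,
    s < 1 -> 2 * eps <= 1 - s & s <= k%:R].
Proof.
move=> k0 t0 s0 hs.
have k1 : 1 <= k%:R :> R by rewrite ler1n.
have T0 : 0 < tau0 by lra.
rewrite ltr_pdivlMr // in hs.
pose tau := (tau0 + (k%:R + 1) / s) / 2.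
have ts : tau * s = (tau0 * s + (k%:R + 1)) / 2 by rewrite /tau; field; rewrite gt_eqF.
pose g := k%:R + 1 - tau * s.
have g0 : 0 < g by rewrite /g ts; lra.
exists tau, (if s < 1 then Num.min g (1 - s) / 2 else g / 2); split.
- have : tau0 < (k%:R + 1) / s by rewrite ltr_pdivlMr // mulrC.
  rewrite /tau; lra.
- case: ifP => s1; last by lra.
  have : 0 < Num.min g (1 - s) by rewrite lt_min g0 subr_gt0.
  lra.
- have : (if s < 1 then Num.min g (1 - s) / 2 else g / 2) <= g / 2.
    by case: ifP => // _; rewrite ler_pM2r ?invr_gt0 // ge_min lexx.
  rewrite /g; lra.
- move=> s1; rewrite s1.
  have : Num.min g (1 - s) <= 1 - s by rewrite ge_min lexx orbT.
  lra.
- nra.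
Qed.

End scales.

(** * Gauss sums *)

Section gauss_dimension.
Context {R : realType}.

(** A centre with a radius. The strict inequality keeps limit points away from 1, which is outside
    [0, 1). *)
Definition interval_node (x : R * R) : Prop :=
  [/\ 0 < x.2 <= 1, 0 <= x.1 - x.2 & x.1 + x.2 < 1].

Definition interval_ball (x : R * R) : set R := [set t | `|t - x.1| <= x.2].

(** Smallness on the whole ball at one length, so that a limit point inherits it from every ball of
    the chain. *)
Definition gauss_small (d k : nat) (x : R * R) : Prop :=
  exists2 N, (k <= N)%N &
    forall t, interval_ball x t -> normc (gauss_sum d t N) <= k.+1%:R^-1.

Lemma sub_ball (t c c' w w' : R) : `|c' - c| <= w - w' -> `|t - c'| <= w' -> `|t - c| <= w.
Proof.
move=> h1 h2; have -> : t - c = (t - c') + (c' - c) by ring.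
by apply: le_trans (ler_normD _ _) _; lra.
Qed.

Lemma interval_node_sub (c w c' w' : R) : interval_node (c, w) -> 0 < w' <= w ->
  `|c' - c| <= w - w' -> interval_node (c', w').
Proof.
move=> [/= /andP[w0 w1] h1 h2] /andP[w'0 w'w]; rewrite ler_norml => /andP[a b].
by split => /=; [apply/andP; split|..]; lra.
Qed.

Lemma interval_endpoints (x y : R * R) : 0 < y.2 ->
  interval_ball y `<=` interval_ball x -> x.1 - x.2 <= y.1 - y.2 /\ y.1 + y.2 <= x.1 + x.2.
Proof.
move=> y0 sub; split.
  have := sub (y.1 - y.2); rewrite /interval_ball /= !ler_norml.
  move=> H; have /andP[] : - x.2 <= y.1 - y.2 - x.1 <= x.2 by apply: H; apply/andP; split; lra.
  lra.
have := sub (y.1 + y.2); rewrite /interval_ball /= !ler_norml.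
move=> H; have /andP[] : - x.2 <= y.1 + y.2 - x.1 <= x.2 by apply: H; apply/andP; split; lra.
lra.
Qed.

Lemma nested_interval_balls (c w : nat -> R) : (forall k, interval_node (c k, w k)) ->
  (forall k, interval_ball (c k.+1, w k.+1) `<=` interval_ball (c k, w k)) ->
  exists2 t, 0 <= t < 1 & forall k, interval_ball (c k, w k) t.
Proof.
move=> nd nest.
have w0 k : 0 < w k by have [/andP[]] := nd k.
have ends k := interval_endpoints (w0 k.+1 : 0 < (c k.+1, w k.+1).2) (nest k).
have [t ht] := @nested_intervals R (fun k => c k - w k) (fun k => c k + w k)
  (fun k => (ends k).1) (fun k => (ends k).2) ltac:(by move=> k; have := w0 k; lra).
exists t.
  have /andP[a b] := ht 0%N; have [_ /= c1 c2] := nd 0%N.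
  by apply/andP; split; lra.
by move=> k; have /andP[a b] := ht k; rewrite /interval_ball /= ler_norml; apply/andP; split; lra.
Qed.

Lemma centers_close (t t' c c' r w : R) : `|t - t'| <= r -> `|t - c| <= w -> `|t' - c'| <= w ->
  `|c - c'| <= r + 2 * w.
Proof. by rewrite !ler_norml => /andP[? ?] /andP[? ?] /andP[? ?]; apply/andP; split; lra. Qed.

Lemma primes_in_bounds (Q k p : nat) : (2 <= Q)%N -> (k <= Q)%N -> p \in primes_in Q ->
  [/\ odd p, (k <= p.*2)%N & (p <= Q.*2)%N].
Proof.
move=> Q2 kQ; rewrite mem_primes_in => /and3P[pp p1 p2]; split => //; last by lia.
by case: (even_prime pp) => // p_eq2; lia.
Qed.

(** The window holds at least p rho / 2 - 1 odd numerators. At most one is a multiple of p, and K =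
    32 d / rho makes the bad ones at most 2 d (2 p) / K = p rho / 8. As p rho >= 16, at least p rho
    / 4 remain. *)
Lemma gauss_fiber_count (d p Q : nat) (x w rho : R) : (0 < d)%N ->
  (2 <= Q)%N -> p \in primes_in Q -> 0 < rho -> rho / 2 <= w -> 16 <= Q%:R * rho ->
  0 <= x - w -> x + w < 1 ->
  rho / 4 * Q%:R <= (count (fun a => [&& admissible Q (p, a), `|frac2 (p, a) - x| <= w &
    good_phase (@gauss_phase R d p.*2 a) p.*2 (32 * d%:R / rho)]) (iota 0 p.*2))%:R.
Proof.
move=> d0 Q2 pQ rho0 wrho Qrho x0 x1.
move: (pQ); rewrite mem_primes_in => /and3P[pp p1 p2].
have p0 := prime_gt0 pp.
have PQ : Q%:R <= p%:R :> R by rewrite ler_nat ltnW.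
have P0 : 0 < p%:R :> R by rewrite ltr0n.
have prho : Q%:R * rho <= p%:R * rho by rewrite ler_pM2r.
have pw : p%:R * rho / 2 <= p%:R * w by rewrite -mulrA ler_pM2l.
have pw1 : 1 <= p%:R * w by lra.
have d1 : 0 < d%:R :> R by rewrite ltr0n.
have K0 : 0 < 32 * d%:R / rho by rewrite divr_gt0 // mulr_gt0.
have cnt1 := count_odd_near p0 x0 x1 pw1.
have bad := @few_bad_phases R p.*2 d.*2 (fun n => (n ^ d)%N) (fun=> 0) _
  ltac:(by rewrite double_gt0) K0 (fun m _ => power_residue_count m pp d0).
rewrite size_filter in bad.
have bad2 : (count (fun a => ~~ good_phase (@gauss_phase R d p.*2 a) p.*2 (32 * d%:R / rho))
    (iota 0 p.*2))%:R <= p%:R * rho / 8 :> R.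
  move: bad; rewrite -ler_pdivlMr // => /le_trans; apply.
  rewrite le_eqVlt; apply/orP; left; apply/eqP.
  by rewrite natrM -!muln2 !natrM; field; rewrite !gt_eqF.
have c1 := count_avoid (iota 0 p.*2) (fun a => odd a && (`|frac2 (p, a) - x| <= w))
  (fun a => odd a && (p %| a)%N).
have c2 := count_avoid (iota 0 p.*2)
  (fun a => (odd a && (`|frac2 (p, a) - x| <= w)) && ~~ (odd a && (p %| a)%N))
  (fun a => ~~ good_phase (@gauss_phase R d p.*2 a) p.*2 (32 * d%:R / rho)).
have c3 := count_dvd_odd p0.
move: c1 c2 c3; rewrite -!(ler_nat R) !natrD => c1 c2 c3.
set goal := count _ _; rewrite (_ : goal = count (fun a =>
  ((odd a && (`|frac2 (p, a) - x| <= w)) && ~~ (odd a && (p %| a)%N)) &&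
  ~~ ~~ good_phase (@gauss_phase R d p.*2 a) p.*2 (32 * d%:R / rho)) (iota 0 p.*2)); last first.
  rewrite /goal; apply: eq_count => a; rewrite negbK /admissible pQ /=.
  by case: (odd a) => //=; rewrite -!andbA andbCA.
rewrite -/(gauss_phase d p.*2) in bad2 c2 *.
lra.
Qed.

Lemma gauss_children (d : nat) (s tau eps : R) :
  (0 < d)%N -> d.+1%:R + 1 / 2 < tau -> 0 < s -> 0 < eps ->
  tau * s + 2 * eps <= 1%:R + 1 -> (s < 1 -> 2 * eps <= 1 - s) -> s <= 1%:R ->
  forall k x, interval_node x -> exists C rho',
    spread_children (@real_dist R) interval_node snd interval_ball (gauss_small d.+1) s
      (4^-1 / (2 * 49)) k x C rho'.
Proof.
move=> d0 htau s0 eps0 gap gap1 s1 k [x rho] nx.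
have [/= /andP[rho0 rho1] x0 x1] := nx.
have tau2 : 2 <= tau.
  have : 1 <= d%:R :> R by rewrite ler1n.
  by move: htau; rewrite -natr1; lra.
pose K := 32 * d.+1%:R / rho.
have K0 : 0 < K by rewrite divr_gt0 // mulr_gt0 // ltr0n.
pose Z1 : R := 16 * d.+1%:R * 4 ^+ d.+2 * Num.sqrt K * k.+1%:R.
have Z10 : 0 <= Z1.
  by apply: mulr_ge0.
(* [Z] adds up what is demanded of Q: [Z1] makes the exponential sum small, 16 / rho lets enough
   fractions into the ball, and the last two are hypotheses of [hit_weight_le] with c = 1 / 4 and D
   = 49. *)
pose Z : R := Z1 + 16 / rho + 2 / rho ^+ 1 + 2 * 49 / (4^-1 * rho ^+ 1).
have z1 : 0 < 16 / rho by rewrite divr_gt0.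
have z2 : 0 < 2 / rho ^+ 1 by rewrite divr_gt0 ?exprn_gt0.
have z3 : 0 < 2 * 49 / (4^-1 * rho ^+ 1) by rewrite divr_gt0 ?mulr_gt0 ?invr_gt0 ?exprn_gt0.
have beta0 : 0 < tau - (d%:R + 3 / 2) by move: htau; rewrite -natr1; lra.
have [Q [kQ Q2 Zeps Zbeta [ZQ Qrho piQ]]] :=
  good_scale Z k eps0 beta0 (lt_le_trans (ltr0Sn R 1) tau2) rho0.
have Q0 : (0 < Q)%N by apply: ltnW.
have QR : 0 < Q%:R :> R by rewrite ltr0n.
set rho' := Q%:R `^ (- tau) in Qrho.
have rho'0 : 0 < rho' by rewrite powR_gt0.
have rho'Q : rho' * Q%:R ^+ 2 <= 1.
  rewrite /rho' powRN mulrC ler_pdivrMr ?powR_gt0 // mul1r -powR_mulrn //.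
  by apply: ler_powR => //; rewrite ler1n.
pose w := rho - rho'.
pose sel := fun i : nat * nat => [&& admissible Q i, `|frac2 i - x| <= w &
    good_phase (@gauss_phase R d.+1 i.1.*2 i.2) i.1.*2 K].
pose C : seq (R * R) := map (fun i => (frac2 i, rho')) (seq.filter sel (pairs_in Q)).
have szC : 4^-1 * rho ^+ 1 * ((size (primes_in Q))%:R * Q%:R ^+ 1) <= (size C)%:R.
  rewrite size_map size_filter count_pairs natr_sum.
  apply: le_trans (_ : \sum_(p <- primes_in Q) (rho / 4 * Q%:R) <= _).
    rewrite big_const_seq count_predT iter_addr_0 -[X in _ <= X]mulr_natl.
    by rewrite le_eqVlt; apply/orP; left; apply/eqP; ring.
  rewrite big_seq [X in _ <= X]big_seq; apply: ler_sum => p pQ.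
  apply: gauss_fiber_count => //; rewrite /w.
  - lra.
  - by rewrite -ler_pdivrMr //; apply: le_trans ZQ; rewrite /Z; lra.
  - lra.
  - lra.
exists C, rho'; split.
- rewrite -(ltr_nat R); apply: lt_le_trans szC.
  rewrite !mulr_gt0 ?exprn_gt0 ?invr_gt0 //; apply: lt_le_trans piQ; exact: powR_gt0.
- exact: Qrho.
- move=> c /mapP[[p a]]; rewrite mem_filter => /andP[/and3P[adm near good] _] ->.
  have /and3P[/= pQ oa _] := adm.
  have sub : interval_ball (frac2 (p, a), rho') `<=` interval_ball (x, rho).
    by move=> t; apply: sub_ball.
  split => //.
    by apply: interval_node_sub nx _ near; apply/andP; split => //; lra.
  have [op kp p2] := primes_in_bounds Q2 kQ pQ.
  exists p.*2 => // t tb.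
  apply: le_trans (gauss_near op oa K0 good tb) _.
  by apply: near_bound_small => //; apply: le_trans Zbeta; rewrite /Z -/Z1; lra.
move=> U r /andP[r0 rr] dU.
pose hs := fun i => sel i && `[< U `&` interval_ball (frac2 i, rho') !=set0 >].
have hE : hits interval_ball U C = count hs (pairs_in Q).
  by rewrite /hits /C count_map count_filter; apply: eq_count => i /=; rewrite /hs andbC.
have [n1 n2] : (count hs (pairs_in Q))%:R <= 1 + 16 * (r + 2 * rho') * Q%:R ^+ 2 /\
  (count hs (pairs_in Q))%:R <= (size (primes_in Q))%:R * (1 + 8 * (r + 2 * rho') * Q%:R).
  apply: pairs_in_count => //; first by rewrite addr_ge0 ?mulr_ge0 // ltW.
    by move=> i /andP[/and3P[]].
  move=> i j /andP[_ /asboolP[t [Ut Bt]]] /andP[_ /asboolP[t' [Ut' Bt']]].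
  exact: centers_close (dU _ _ Ut Ut') Bt Bt'.
have [h1 h2 h3] := pair_hit_bounds Q0 (ler0n _ _) rho'0 r0 rho'Q n1 n2.
rewrite hE; apply: (@hit_weight_le _ 1 _ (size (primes_in Q)) _ _ s tau eps) => //.
- by rewrite rho0.
- by apply: le_trans Zeps; rewrite /Z; lra.
- by apply: le_trans Zeps; rewrite /Z; lra.
- by rewrite r0.
- move=> /h1 h; apply: le_trans h _; rewrite expr1 ler_wpM2r ?mulr_ge0 // ?ltW //; lra.
- by move=> /andP[/h2].
Qed.

Lemma gauss_dim_ge (d : nat) : (0 < d)%N ->
  ((4 / (2 * d.+1%:R + 1) : R)%:E <= hausdorff_dim (@real_dist R) (Z_G R d.+1))%E.
Proof.
move=> d0; apply: le_ereal_inf_tmp => _ [s [s0 Hs] <-]; rewrite lee_fin leNgt; apply/negP => hs.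
have d1 : 1 <= d%:R :> R by rewrite ler1n.
have hA : 5 / 2 <= d.+1%:R + 1 / 2 :> R by rewrite -natr1; lra.
have hB : s < (1%:R + 1) / (d.+1%:R + 1 / 2).
  have -> : (1%:R + 1) / (d.+1%:R + 1 / 2) = 4 / (2 * d.+1%:R + 1) :> R; last by [].
  have -> : d.+1%:R + 1 / 2 = (2 * d.+1%:R + 1) / 2 :> R by field.
  by rewrite invfM invrK; ring.
have [tau [eps [t1 t2 t3 t4 t5]]] := exponents_exist (ltn0Sn 0) hA s0 hB.
apply: (@hausdorff_measure_cantor_neq0 R R (@real_dist R) (R * R)%type interval_node snd
  interval_ball (gauss_small d.+1) s (4^-1 / (2 * 49)) (Z_G R d.+1) (1 / 2, 1 / 4)) => //.
- by move=> x [/andP[]].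
- exact: (gauss_children d0 t1 s0 t2 t3 t4 t5).
- move=> xs nd sm nest _.
  have xsE k : xs k = ((xs k).1, (xs k).2) by case: (xs k).
  have [||t t01 Bt] := @nested_interval_balls (fun k => (xs k).1) (fun k => (xs k).2).
  - by move=> k; rewrite -xsE.
  - by move=> k; rewrite -!xsE.
  exists t => [|k]; last by rewrite xsE.
  split => //.
  apply: limn_einf_eq0 => [n|k]; first exact: normc_ge0.
  by have [N kN h] := sm k; exists N => //; apply: h; rewrite xsE.
- by split => /=; [apply/andP; split|..]; lra.
Qed.

End gauss_dimension.

(** * Weyl sums *)

Section weyl_dimension.
Context {R : realType} (d : nat).

Definition plane_point (u v : R) : 'rV[R]_d.+2 :=
  \row_(i < d.+2) (if (i : nat) == 0%N then u else if (i : nat) == 1%N then v else 0).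

Lemma plane_point0 u v : plane_point u v 0 0 = u.
Proof. by rewrite mxE. Qed.

Lemma plane_point1 u v : plane_point u v 0 1 = v.
Proof. by rewrite mxE. Qed.

Lemma weyl_sum_plane u v N :
  weyl_sum (plane_point u v) N = exp_sum (fun n => u * n%:R + v * n%:R ^+ 2) N.
Proof.
rewrite /weyl_sum /exp_sum; apply: eq_bigr => n _; congr e.
rewrite big_ord_recl big_ord_recl big1 => [|i _]; last by rewrite mxE /= mul0r.
by rewrite !mxE /= expr1 addr0.
Qed.

Lemma euclidean_dist_coord (x y : 'rV[R]_d.+2) i : `|x 0 i - y 0 i| <= euclidean_dist x y.
Proof.
rewrite /euclidean_dist -sqrtr_sqr ler_wsqrtr // (bigD1 i) //= lerDl.
by apply: sumr_ge0 => j _; apply: sqr_ge0.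
Qed.

Definition square_node (x : R * R * R) : Prop :=
  interval_node (x.1.1, x.2) /\ interval_node (x.1.2, x.2).

(** A two-dimensional square, not a ball of the ambient space: the further coordinates are 0. *)
Definition square (x : R * R * R) : set 'rV[R]_d.+2 :=
  [set t | exists u v, [/\ interval_ball (x.1.1, x.2) u, interval_ball (x.1.2, x.2) v &
    t = plane_point u v]].

Definition weyl_small (k : nat) (x : R * R * R) : Prop :=
  exists2 N, (k <= N)%N & forall t, square x t -> normc (weyl_sum t N) <= k.+1%:R^-1.

Lemma residue_count (q m : nat) : (0 < m <= q)%N ->
  (size [seq n <- index_iota 1 q.+1 | m == n %[mod q]] <= 1)%N.
Proof.
move=> /andP[m0 mq]; rewrite -[1%N]/(size [:: m]); apply: uniq_leq_size.
  by rewrite filter_uniq // iota_uniq.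
move=> n; rewrite mem_filter mem_index_iota inE ltnS => /andP[/eqP e /andP[n0 nq]].
have [nlt|nge] := ltnP n q; have [mlt|mge] := ltnP m q.
- by rewrite !modn_small // in e; rewrite e.
- have mE : m = q by apply/eqP; rewrite eqn_leq mq.
  by rewrite mE modnn modn_small // in e; rewrite -e in n0.
- have nE : n = q by apply/eqP; rewrite eqn_leq nq.
  by rewrite nE modnn modn_small // in e; rewrite e in m0.
- by rewrite eqn_leq (leq_trans nq mge) (leq_trans mq nge).
Qed.

(** Each residue occurs once among 1, ..., 2p, so c = 1, and K = 16 / rho again leaves at most p rho
    / 8 bad numerators. *)
Lemma weyl_fiber_count (p Q a : nat) (x w rho : R) :
  (2 <= Q)%N -> p \in primes_in Q -> 0 < rho -> rho / 2 <= w -> 16 <= Q%:R * rho ->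
  0 <= x - w -> x + w < 1 ->
  rho / 4 * Q%:R <= (count (fun b => (`|b%:R / p%:R - x| <= w) &&
    good_phase (@weyl_phase R p.*2 a b.*2) p.*2 (16 / rho)) (iota 0 p))%:R.
Proof.
move=> Q2 pQ rho0 wrho Qrho x0 x1.
move: (pQ); rewrite mem_primes_in => /and3P[pp p1 p2].
have p0 := prime_gt0 pp.
have PQ : Q%:R <= p%:R :> R by rewrite ler_nat ltnW.
have P0 : 0 < p%:R :> R by rewrite ltr0n.
have prho : Q%:R * rho <= p%:R * rho by rewrite ler_pM2r.
have pw : p%:R * rho / 2 <= p%:R * w by rewrite -mulrA ler_pM2l.
have pw1 : 1 <= p%:R * w by lra.
have K0 : 0 < 16 / rho by rewrite divr_gt0.
have cnt1 := count_near p0 x0 x1 pw1.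
have bad := @few_bad_phases R p.*2 1 (fun n => n) (fun n => a%:R * ((n ^ 2)%:R / p.*2%:R)) _
  ltac:(by rewrite double_gt0) K0 (@residue_count p.*2).
rewrite size_filter in bad.
(* The average covers all linear numerators modulo 2p; doubling embeds the even ones used here among
   them. *)
have dbl : (count (fun b => ~~ good_phase (@weyl_phase R p.*2 a b.*2) p.*2 (16 / rho)) (iota 0 p)
   <= count (fun b => ~~ good_phase (@weyl_phase R p.*2 a b) p.*2 (16 / rho)) (iota 0 p.*2))%N.
  rewrite -!size_filter -(size_map double); apply: uniq_leq_size.
    by rewrite map_inj_uniq; [rewrite filter_uniq // iota_uniq | exact: double_inj].
  move=> y /mapP[b]; rewrite !mem_filter !mem_iota !add0n => /andP[hb bp] ->.
  by rewrite hb /= ltn_double.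
have bad2 : (count (fun b => ~~ good_phase (@weyl_phase R p.*2 a b) p.*2 (16 / rho))
    (iota 0 p.*2))%:R <= p%:R * rho / 8 :> R.
  move: bad; rewrite -ler_pdivlMr // => /le_trans; apply.
  rewrite le_eqVlt; apply/orP; left; apply/eqP.
  by rewrite mul1n -!muln2 !natrM; field; rewrite !gt_eqF.
have c2 := count_avoid (iota 0 p) (fun b => `|b%:R / p%:R - x| <= w)
  (fun b => ~~ good_phase (@weyl_phase R p.*2 a b.*2) p.*2 (16 / rho)).
move: c2 dbl; rewrite -!(ler_nat R) !natrD => c2 dbl.
under eq_count do rewrite -[good_phase _ _ _]negbK.
lra.
Qed.

(** No phase condition on a: [weyl_fiber_count] provides enough good b for every a. *)
Lemma admissible_fiber_count (p Q : nat) (x w rho : R) :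
  (2 <= Q)%N -> p \in primes_in Q -> 0 < rho -> rho / 2 <= w -> 16 <= Q%:R * rho ->
  0 <= x - w -> x + w < 1 ->
  rho / 4 * Q%:R <= (count (fun a => admissible Q (p, a) && (`|frac2 (p, a) - x| <= w))
    (iota 0 p.*2))%:R.
Proof.
move=> Q2 pQ rho0 wrho Qrho x0 x1.
move: (pQ); rewrite mem_primes_in => /and3P[pp p1 p2].
have p0 := prime_gt0 pp.
have PQ : Q%:R <= p%:R :> R by rewrite ler_nat ltnW.
have P0 : 0 < p%:R :> R by rewrite ltr0n.
have prho : Q%:R * rho <= p%:R * rho by rewrite ler_pM2r.
have pw : p%:R * rho / 2 <= p%:R * w by rewrite -mulrA ler_pM2l.
have pw1 : 1 <= p%:R * w by lra.
have cnt1 := count_odd_near p0 x0 x1 pw1.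
have c1 := count_avoid (iota 0 p.*2) (fun a => odd a && (`|frac2 (p, a) - x| <= w))
  (fun a => odd a && (p %| a)%N).
have c3 := count_dvd_odd p0.
move: c1 c3; rewrite -!(ler_nat R) !natrD => c1 c3.
set goal := count _ _; rewrite (_ : goal = count (fun a =>
  (odd a && (`|frac2 (p, a) - x| <= w)) && ~~ (odd a && (p %| a)%N)) (iota 0 p.*2)); last first.
  rewrite /goal; apply: eq_count => a; rewrite /admissible pQ /=.
  by case: (odd a) => //=; rewrite andbC.
lra.
Qed.

Definition triples_in (Q : nat) : seq (nat * nat * nat) :=
  [seq (i, b) | i <- pairs_in Q, b <- iota 0 i.1].

(** Fibring over the pairs (p, a): [N1] counts the pairs that occur and [N2] bounds the numerators b
    over one pair. They are kept apart because the ranges of r call for different bounds on [N1]. *)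
Lemma triples_in_count (Q : nat) (h : pred (nat * nat * nat)) (L : R) : (0 < Q)%N -> 0 <= L ->
  {in h, forall j, admissible Q j.1} ->
  {in h &, forall j j', `|frac2 j.1 - frac2 j'.1| <= L} ->
  {in h &, forall j j', `|j.2%:R / j.1.1%:R - j'.2%:R / j'.1.1%:R| <= L} ->
  exists N1 N2 : R, [/\ (count h (triples_in Q))%:R <= N1 * N2,
    0 <= N1 /\ 0 <= N2, N1 <= 1 + 16 * L * Q%:R ^+ 2,
    N1 <= (size (primes_in Q))%:R * (1 + 8 * L * Q%:R) & N2 <= 1 + 8 * L * Q%:R].
Proof.
move=> Q0 L0 adm near1 near2.
pose p1 := fun i => has (fun b => h (i, b)) (iota 0 i.1).
have [n1 n2] : (count p1 (pairs_in Q))%:R <= 1 + 16 * L * Q%:R ^+ 2 /\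
  (count p1 (pairs_in Q))%:R <= (size (primes_in Q))%:R * (1 + 8 * L * Q%:R).
  apply: pairs_in_count => //.
    by move=> i /hasP[b _ /adm].
  by move=> i j /hasP[b _ hb] /hasP[b' _ hb']; apply: (near1 (i, b) (j, b')).
have N20 : 0 <= 1 + 8 * L * Q%:R by rewrite addr_ge0 // !mulr_ge0.
exists (count p1 (pairs_in Q))%:R, (1 + 8 * L * Q%:R); split => //.
rewrite count_pairs natr_sum -sum1_count natr_sum mulr_suml.
rewrite [X in _ <= X]big_mkcond; apply: ler_sum => i _.
case: ifPn => [/hasP[b0 _ hb0]|hn]; last first.
  by move: hn; rewrite /p1 has_count -leqNgt leqn0 => /eqP ->.
rewrite mul1r -size_filter; apply: (@multiples_count _ _ i.1) => //.
- have /and3P[+ _ _] := adm _ hb0; rewrite /= mem_primes_in => /and3P[/prime_gt0 -> _ /=].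
  by move=> h2; apply: leq_trans h2 _; lia.
- by rewrite filter_uniq // iota_uniq.
- by move=> a b; rewrite !mem_filter => /andP[ha _] /andP[hb _]; apply: (near2 (i, a) (i, b)).
Qed.

(** The density 1 / 16 is the square of 1 / 4, one factor per coordinate, and 25 * 49 is the product
    of the constants of [fiber_hit_bounds] and [pair_hit_bounds]. *)
Lemma weyl_children (D s tau eps : R) :
  25 * 49 <= D -> 5 / 2 < tau -> 0 < s -> 0 < eps ->
  tau * s + 2 * eps <= 2%:R + 1 -> (s < 1 -> 2 * eps <= 1 - s) -> s <= 2%:R ->
  forall k x, square_node x -> exists C rho',
    spread_children (@euclidean_dist R d.+2) square_node snd square weyl_small s
      (16^-1 / (2 * D)) k x C rho'.
Proof.
move=> hD htau s0 eps0 gap gap1 s2 k [[x y] rho] nx.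
have D0 : 0 < D by lra.
have [/= nx1 nx2] := nx.
have [/= /andP[rho0 rho1] x0 x1] := nx1; have [/= _ y0 y1] := nx2.
have tau2 : 2 <= tau by lra.
pose K := 16 / rho.
have K0 : 0 < K by rewrite divr_gt0.
pose Z1 : R := 16 * 2%:R * 4 ^+ 3 * Num.sqrt K * k.+1%:R.
have Z10 : 0 <= Z1 by apply: mulr_ge0.
pose Z : R := Z1 + 16 / rho + 2 / rho ^+ 2 + 2 * D / (16^-1 * rho ^+ 2).
have z1 : 0 < 16 / rho by rewrite divr_gt0.
have z2 : 0 < 2 / rho ^+ 2 by rewrite divr_gt0 ?exprn_gt0.
have z3 : 0 < 2 * D / (16^-1 * rho ^+ 2) by rewrite divr_gt0 ?mulr_gt0 ?invr_gt0 ?exprn_gt0.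
have beta0 : 0 < tau - (1%:R + 3 / 2) by lra.
have [Q [kQ Q2 Zeps Zbeta [ZQ Qrho piQ]]] :=
  good_scale Z k eps0 beta0 (lt_le_trans (ltr0Sn R 1) tau2) rho0.
have Q0 : (0 < Q)%N by apply: ltnW.
have QR : 0 < Q%:R :> R by rewrite ltr0n.
set rho' := Q%:R `^ (- tau) in Qrho.
have rho'0 : 0 < rho' by rewrite powR_gt0.
have rho'Q : rho' * Q%:R ^+ 2 <= 1.
  rewrite /rho' powRN mulrC ler_pdivrMr ?powR_gt0 // mul1r -powR_mulrn //.
  by apply: ler_powR => //; rewrite ler1n.
pose w := rho - rho'.
pose sel := fun j : nat * nat * nat => (admissible Q j.1 && (`|frac2 j.1 - y| <= w)) &&
  ((`|j.2%:R / j.1.1%:R - x| <= w) &&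
   good_phase (@weyl_phase R j.1.1.*2 j.1.2 j.2.*2) j.1.1.*2 K).
pose pt := fun j : nat * nat * nat => (j.2%:R / j.1.1%:R : R, frac2 j.1 : R, rho').
pose C : seq (R * R * R) := map pt (seq.filter sel (triples_in Q)).
have [w1 w2] : rho / 2 <= w /\ 16 <= Q%:R * rho.
  split; first by rewrite /w; lra.
  by rewrite -ler_pdivrMr //; apply: le_trans ZQ; rewrite /Z; lra.
have [x0' x1' y0' y1'] : [/\ 0 <= x - w, x + w < 1, 0 <= y - w & y + w < 1].
  by rewrite /w; split; lra.
have rQ0 : 0 <= rho / 4 * Q%:R by rewrite mulr_ge0 // divr_ge0 // ltW.
have szC : 16^-1 * rho ^+ 2 * ((size (primes_in Q))%:R * Q%:R ^+ 2) <= (size C)%:R.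
  rewrite size_map size_filter count_pairs.
  apply: le_trans (_ : \sum_(p <- primes_in Q) (rho / 4 * Q%:R) ^+ 2 <= _).
    rewrite big_const_seq count_predT iter_addr_0 -[X in _ <= X]mulr_natl.
    by rewrite le_eqVlt; apply/orP; left; apply/eqP; field.
  rewrite big_allpairs_dep /= natr_sum.
  rewrite big_seq [X in _ <= X]big_seq; apply: ler_sum => p pQ.
  apply: le_trans (_ : (count (fun a => admissible Q (p, a) && (`|frac2 (p, a) - y| <= w))
    (iota 0 p.*2))%:R * (rho / 4 * Q%:R) <= _).
    rewrite expr2 ler_wpM2r //; exact: admissible_fiber_count.
  rewrite -sum1_count natr_sum mulr_suml natr_sum big_mkcond; apply: ler_sum => a _.
  rewrite /sel /=; case: ifP => hpa; last by rewrite ler0n.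
  by rewrite mul1r; apply: weyl_fiber_count.
exists C, rho'; split.
- rewrite -(ltr_nat R); apply: lt_le_trans szC.
  rewrite !mulr_gt0 ?exprn_gt0 ?invr_gt0 //; apply: lt_le_trans piQ; exact: powR_gt0.
- exact: Qrho.
- move=> c /mapP[[[p a] b]]; rewrite mem_filter.
  move=> /andP[/andP[/andP[/= adm near1] /andP[near2 good]] _] ->.
  have /and3P[/= pQ oa _] := adm.
  have rr' : 0 < rho' <= rho by apply/andP; split => //; lra.
  split => //.
  + split; [exact: interval_node_sub nx1 rr' near2 | exact: interval_node_sub nx2 rr' near1].
  + have [op kp p2] := primes_in_bounds Q2 kQ pQ.
    exists p.*2 => // t [u [v [/= hu hv ->]]]; rewrite weyl_sum_plane.
    apply: le_trans (weyl_near op oa K0 good hu hv) _.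
    by apply: near_bound_small => //; apply: le_trans Zbeta; rewrite /Z -/Z1; lra.
  + move=> t [u [v [/= hu hv ->]]]; exists u, v; split => //=.
      exact: sub_ball near2 hu.
    exact: sub_ball near1 hv.
move=> U r /andP[r0 rr] dU.
pose hs := fun j => sel j && `[< U `&` square (pt j) !=set0 >].
have hE : hits square U C = count hs (triples_in Q).
  by rewrite /hits /C count_map count_filter; apply: eq_count => j /=; rewrite /hs andbC.
have L0 : 0 <= r + 2 * rho' by rewrite addr_ge0 ?mulr_ge0 // ltW.
have [||| N1 [N2 [hN [N10 N20] n1 n2 n3]]] := @triples_in_count Q hs (r + 2 * rho') Q0 L0.
- by move=> j /andP[/andP[/andP[]]].
- move=> j j' /andP[_ /asboolP[t [Ut [u [v [/= hu hv et]]]]]].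
  move=> /andP[_ /asboolP[t' [Ut' [u' [v' [/= hu' hv' et']]]]]].
  have := le_trans (euclidean_dist_coord t t' 1) (dU _ _ Ut Ut').
  rewrite et et' !plane_point1 => h; exact: centers_close h hv hv'.
- move=> j j' /andP[_ /asboolP[t [Ut [u [v [/= hu hv et]]]]]].
  move=> /andP[_ /asboolP[t' [Ut' [u' [v' [/= hu' hv' et']]]]]].
  have := le_trans (euclidean_dist_coord t t' 0) (dU _ _ Ut Ut').
  rewrite et et' !plane_point0 => h; exact: centers_close h hu hu'.
have [h1 h2 h3] := pair_hit_bounds Q0 (ler0n _ _) rho'0 r0 rho'Q n1 n2.
have [f1 f2] := fiber_hit_bounds Q0 rho'0 r0 rho'Q n3.
have rho'V : rho' <= Q%:R^-1.
  rewrite -powR_inv1 // /rho'; apply: ler_powR; [by rewrite ler1n | lra].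
rewrite hE; apply: (@hit_weight_le _ 2 _ (size (primes_in Q)) _ _ s tau eps) => //.
- by rewrite rho0.
- by apply: le_trans Zeps; rewrite /Z; lra.
- by apply: le_trans Zeps; rewrite /Z; lra.
- by rewrite r0.
- move=> hr; apply: le_trans hN _; apply: le_trans (ler_pM N10 N20 (h1 hr) (f1 hr)) _.
  have g0 : 0 <= (size (primes_in Q))%:R * (r * Q%:R) ^+ 2.
    by rewrite mulr_ge0 ?exprn_ge0 ?mulr_ge0 // ltW.
  have := ler_wpM2r g0 hD; lra.
- move=> /andP[hr1 hr2]; apply: le_trans hN _.
  apply: le_trans (ler_pM N10 N20 (h2 hr1) (f2 hr2)) _.
  have g0 : 0 <= 1 + r * Q%:R ^+ 2 by rewrite addr_ge0 // mulr_ge0 ?exprn_ge0 // ltW.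
  have := ler_wpM2r g0 hD; lra.
- move=> hr; apply: le_trans hN _.
  apply: le_trans (ler_pM N10 N20 (h3 hr) (f2 (lt_le_trans hr rho'V))) _; lra.
Qed.

(** Each coordinate is tested on points of the square [a] whose other coordinate is its centre. *)
Lemma square_sub (a b : R * R * R) : 0 <= a.2 -> square a `<=` square b ->
  interval_ball (a.1.1, a.2) `<=` interval_ball (b.1.1, b.2) /\
  interval_ball (a.1.2, a.2) `<=` interval_ball (b.1.2, b.2).
Proof.
move=> a0 sub; split => u hu.
  have : square a (plane_point u a.1.2).
    by exists u, a.1.2; split => //; rewrite /interval_ball /= subrr normr0.
  move=> /sub[u' [v' [hu' _ e]]].
  by have := congr1 (fun m : 'rV_d.+2 => m 0 0) e; rewrite !plane_point0 => ->.
have : square a (plane_point a.1.1 u).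
  by exists a.1.1, u; split => //; rewrite /interval_ball /= subrr normr0.
move=> /sub[u' [v' [_ hv' e]]].
by have := congr1 (fun m : 'rV_d.+2 => m 0 1) e; rewrite !plane_point1 => ->.
Qed.

Lemma weyl_dim_ge :
  ((6 / 5 : R)%:E <= hausdorff_dim (@euclidean_dist R d.+2) (Z_W R d.+2))%E.
Proof.
apply: le_ereal_inf_tmp => _ [s [s0 Hs] <-]; rewrite lee_fin leNgt; apply/negP => hs.
have hB : s < (2%:R + 1) / (5 / 2) by lra.
have [tau [eps [t1 t2 t3 t4 t5]]] := exponents_exist (ltn0Sn 1) (lexx _) s0 hB.
apply: (@hausdorff_measure_cantor_neq0 R 'rV[R]_d.+2 (@euclidean_dist R d.+2) (R * R * R)%type
  square_node snd square weyl_small s (16^-1 / (2 * (25 * 49))) (Z_W R d.+2)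
  (1 / 2, 1 / 2, 1 / 4)) => //.
- by move=> x [[/andP[]]].
- exact: (weyl_children (lexx _) t1 s0 t2 t3 t4 t5).
- move=> xs nd sm nest _.
  have w0 k : 0 <= (xs k).2 by have [[/andP[/ltW]]] := nd k.
  have [u u01 hu] := @nested_interval_balls R (fun k => (xs k).1.1) (fun k => (xs k).2)
    (fun k => (nd k).1) (fun k => (square_sub (w0 k.+1) (nest k)).1).
  have [v v01 hv] := @nested_interval_balls R (fun k => (xs k).1.2) (fun k => (xs k).2)
    (fun k => (nd k).2) (fun k => (square_sub (w0 k.+1) (nest k)).2).
  have Bt k : square (xs k) (plane_point u v) by exists u, v.
  exists (plane_point u v) => //; split.
    by move=> i; rewrite mxE; case: ifP => // _; case: ifP => // _; rewrite lexx ltr01.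
  apply: limn_einf_eq0 => [n|k]; first exact: normc_ge0.
  by have [N kN h] := sm k; exists N => //; apply: h.
- by split; split => /=; first (by apply/andP; split; lra); lra.
Qed.

End weyl_dimension.

Theorem theorem1p12 (R : realType) (d : nat) (hd : (2 <= d)%N) :
  ((6 / 5 : R)%:E <= hausdorff_dim (@euclidean_dist R d) (Z_W R d))%E /\
  ((4 / (2 * d%:R + 1) : R)%:E <= hausdorff_dim (@real_dist R) (Z_G R d))%E.
Proof.
case: d hd => [|[|d]] // _; split; first exact: weyl_dim_ge.
exact: gauss_dim_ge.
Qed.
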